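(* Let $\mathcal{X}\subseteq\mathbb{R}^{d_1}$ be non-empty, closed and convex, and let $f_t,g_t:\mathcal{X}\times\mathbb{R}^{d_2}\to\mathbb{R}$, $t\in[T]$. Assume that for all $t\in[T]$ and all $\mathbf{z}=[\mathbf{x};\mathbf{y}]$, $\mathbf{z}'=[\mathbf{x}';\mathbf{y}']$ in $\mathcal{X}\times\mathbb{R}^{d_2}$: (i) $|f_t(\mathbf{z})-f_t(\mathbf{z}')|\le \ell_{f,0}\|\mathbf{z}-\mathbf{z}'\|$; (ii) $\mathbf{y}\mapsto g_t(\mathbf{x},\mathbf{y})$ is $\mu_g$-strongly convex with $\mu_g>0$; (iii) $\nabla f_t$, $\nabla g_t$, $\nabla^2 g_t$ are Lipschitz continuous in $\mathbf{z}$ with constants $\ell_{f,1},\ell_{g,1},\ell_{g,2}$ respectively; (iv) $\|\mathbf{x}-\mathbf{x}'\|\le D$ for all $\mathbf{x},\mathbf{x}'\in\mathcal{X}$, and the initialization satisfies $\|\mathbf{y}_1-\mathbf{y}_1^*(\mathbf{x}_1)\|\le D'$; (v) the functions $\mathbf{x}\mapsto f_t(\mathbf{x},\mathbf{y}_t^*(\mathbf{x}))$, $t\in[T]$, are $\mu_f$-strongly convex on $\mathcal{X}$, $\mu_f>0$. Run OAGD (with window size $w=1$) with, for all $t\in[T]$, $$\beta_t=\beta=\frac{2}{\ell_{g,1}+\mu_g},\qquad \alpha_t=\alpha\le\min\Big\{\frac{1}{\ell_{f,1}},\frac{\mu_f}{128M_f^2L_{\mathbf{y}}^2}\Big\},$$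 $$K_t=K>\Big\lceil 0.25(\kappa_g+1)\log\Big(4\big(\tfrac{1}{\alpha\mu_f}+2\big)^2\Big)\Big\rceil .$$ Then $$\mathrm{BD\text{-}Reg}_T\le \mathcal{O}\Big(1+\min\Big\{S_{1,T},\ \sum_{t=1}^T\big\|\nabla f_t(\mathbf{x}_t^*,\mathbf{y}_t^*(\mathbf{x}_t^* ))\big\|^2+S_{2,T}\Big\}\Big).$$
   Context: Notation: $[T]=\{1,\dots,T\}$, $\|\cdot\|$ is the Euclidean (or induced operator) norm, $\kappa_g=\ell_{g,1}/\mu_g$. Assumption (iii) implicitly includes that $f_t$ is differentiable and $g_t$ twice differentiable. $\mathbf{y}_t^*(\mathbf{x})=\arg\min_{\mathbf{y}\in\mathbb{R}^{d_2}}g_t(\mathbf{x},\mathbf{y})$ and $\mathbf{x}_t^*\in\arg\min_{\mathbf{x}\in\mathcal{X}}f_t(\mathbf{x},\mathbf{y}_t^*(\mathbf{x}))$. $\nabla f_t(\mathbf{x},\mathbf{y}_t^*(\mathbf{x}))$ is the gradient of $\mathbf{x}\mapsto f_t(\mathbf{x},\mathbf{y}_t^*(\mathbf{x}))$, i.e. $\nabla_{\mathbf{x}}f_t(\mathbf{x},\mathbf{y}_t^*(\mathbf{x}))+\nabla\mathbf{y}_t^*(\mathbf{x})\nabla_{\mathbf{y}}f_t(\mathbf{x},\mathbf{y}_t^*(\mathbf{x}))$. Constants: $L_{\mathbf{y}}=\ell_{g,1}/\mu_g$ and $M_f=\ell_{f,1}+\frac{\ell_{g,1}\ell_{f,1}}{\mu_g}+\frac{\ell_{f,0}}{\mu_g}\big(\ell_{g,2}+\frac{\ell_{g,1}\ell_{g,2}}{\mu_g}\big)$.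 Approximate hypergradient: $\tilde\nabla f_t(\mathbf{x},\mathbf{y})=\nabla_{\mathbf{x}}f_t(\mathbf{x},\mathbf{y})+\mathbf{M}_t(\mathbf{x},\mathbf{y})\nabla_{\mathbf{y}}f_t(\mathbf{x},\mathbf{y})$, where $\mathbf{M}_t(\mathbf{x},\mathbf{y})\in\mathbb{R}^{d_1\times d_2}$ solves $\mathbf{M}_t(\mathbf{x},\mathbf{y})\nabla^2_{\mathbf{y}}g_t(\mathbf{x},\mathbf{y})+\nabla^2_{\mathbf{x}\mathbf{y}}g_t(\mathbf{x},\mathbf{y})=0$. OAGD (online alternating gradient descent) with $w=1$: start from $(\mathbf{x}_1,\mathbf{y}_1)\in\mathcal{X}\times\mathbb{R}^{d_2}$. For $t=1,\dots,T$: set $\mathbf{z}_t^1=\mathbf{y}_t$; for $k=1,\dots,K_t$ set $\mathbf{z}_t^{k+1}=\mathbf{z}_t^k-\beta_t\nabla_{\mathbf{y}}g_t(\mathbf{x}_t,\mathbf{z}_t^k)$; set $\mathbf{y}_{t+1}=\mathbf{z}_t^{K_t+1}$ and $\mathbf{x}_{t+1}=\Pi_{\mathcal{X}}[\mathbf{x}_t-\alpha_t\tilde\nabla f_t(\mathbf{x}_t,\mathbf{y}_{t+1})]$, with $\Pi_{\mathcal{X}}$ the Euclidean projection. Stepsizes $\alpha_t,\beta_t$ are positive. Bilevel dynamic regret: $\mathrm{BD\text{-}Reg}_T=\sum_{t=1}^T\big(f_t(\mathbf{x}_t,\mathbf{y}_t^*(\mathbf{x}_t))-f_t(\mathbf{x}_t^*,\mathbf{y}_t^*(\mathbf{x}_t^*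 ))\big)$. Path-lengths: $P_{p,T}=\sum_{t=2}^T\|\mathbf{x}_{t-1}^*-\mathbf{x}_t^*\|^p$, $Y_{p,T}=\sum_{t=2}^T\|\mathbf{y}_{t-1}^*(\mathbf{x}_{t-1}^* )-\mathbf{y}_t^*(\mathbf{x}_t^* )\|^p$, $S_{p,T}=P_{p,T}+Y_{p,T}$. The constant hidden in $\mathcal{O}$ depends only on $\ell_{f,0},\ell_{f,1},\ell_{g,1},\ell_{g,2},\mu_f,\mu_g,D,D',\alpha$ and not on $T$ or otherwise on the function sequence. *)

(* Defs.v *)
From mathcomp Require Import all_boot all_order all_algebra.
From mathcomp Require Import all_classical all_reals all_analysis.
Set Implicit Arguments.
Unset Strict Implicit.
Unset Printing Implicit Defensive.
Import Order.TTheory GRing.Theory Num.Theory.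
Import numFieldNormedType.Exports.
Local Open Scope classical_set_scope.
Local Open Scope ring_scope.

(* The library norm on matrices is the sup norm, so the Euclidean and induced
   operator norms are defined here.  Both norms give the same topology, so the
   library's [closed], [nbhs] and [within] are used as they are. *)
Section Euclidean.
Context {R : realType}.

Definition dot n (u v : 'cV[R]_n) : R := \sum_i u i 0 * v i 0.

Definition enorm n (u : 'cV[R]_n) : R := Num.sqrt (dot u u).

Definition opnorm m n (A : 'M[R]_(m, n)) : R :=
  sup [set enorm (A *m u) | u in [set u : 'cV[R]_n | enorm u <= 1]].

End Euclidean.

Section Calculus.
Context {R : realType}.

(* Derivatives are taken relative to a set A (first-order expansion along
   points of A only): the functions of interest live on X x R^d2 with X merely
   closed and convex.  At a point where A is a neighbourhood these are the usual
   Frechet gradient and Jacobian. *)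
Definition is_gradient_on n (A : set 'cV[R]_n) (h : 'cV[R]_n -> R)
    (z v : 'cV[R]_n) : Prop :=
  forall eps : R, 0 < eps ->
    \forall z' \near within A (nbhs z),
      `|h z' - h z - dot v (z' - z)| <= eps * enorm (z' - z).

Definition is_jacobian_on m n (A : set 'cV[R]_n) (G : 'cV[R]_n -> 'cV[R]_m)
    (z : 'cV[R]_n) (J : 'M[R]_(m, n)) : Prop :=
  forall eps : R, 0 < eps ->
    \forall z' \near within A (nbhs z),
      enorm (G z' - G z - J *m (z' - z)) <= eps * enorm (z' - z).

(* Unique when A is convex with non-empty interior; otherwise some choice of a
   gradient (its component tangent to A is still uniquely determined). *)
Definition gradient_on n (A : set 'cV[R]_n) (h : 'cV[R]_n -> R)
    (z : 'cV[R]_n) : 'cV[R]_n :=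
  get [set v | is_gradient_on A h z v].

Definition strongly_convex_on n (A : set 'cV[R]_n) (mu : R)
    (h : 'cV[R]_n -> R) : Prop :=
  forall (u v : 'cV[R]_n) (l : R), A u -> A v -> 0 <= l <= 1 ->
    h (l *: u + (1 - l) *: v) <=
    l * h u + (1 - l) * h v - mu / 2 * l * (1 - l) * enorm (u - v) ^+ 2.

Definition argmin_set n (A : set 'cV[R]_n) (h : 'cV[R]_n -> R) :
    set 'cV[R]_n :=
  [set u | A u /\ forall v, A v -> h u <= h v].

Definition argmin n (A : set 'cV[R]_n) (h : 'cV[R]_n -> R) : 'cV[R]_n :=
  get (argmin_set A h).

Definition proj n (A : set 'cV[R]_n) (p : 'cV[R]_n) : 'cV[R]_n :=
  argmin A (fun u => enorm (u - p)).

End Calculus.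

(* A point z = [x; y] of R^d1 x R^d2 is the stacked column [col_mx x y];
   [usubmx]/[dsubmx] select its x and y parts. *)
Section Bilevel.
Context {R : realType} {d1 d2 : nat}.

Definition cylinder (X : set 'cV[R]_d1) : set 'cV[R]_(d1 + d2) :=
  [set z | X (usubmx z)].

Definition ystar (g : 'cV[R]_(d1 + d2) -> R) (x : 'cV[R]_d1) : 'cV[R]_d2 :=
  argmin setT (fun y => g (col_mx x y)).

Definition outer (f g : 'cV[R]_(d1 + d2) -> R) (x : 'cV[R]_d1) : R :=
  f (col_mx x (ystar g x)).

(* The Hessian is the Jacobian of the gradient, so its upper right block has
   entries d/dy_j (d/dx_i g): the d1 x d2 matrix usually written as the xy
   second derivative. *)
Definition hess_xy (H : 'M[R]_(d1 + d2)) : 'M[R]_(d1, d2) := ursubmx H.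
Definition hess_yy (H : 'M[R]_(d1 + d2)) : 'M[R]_d2 := drsubmx H.

Definition hypergrad (gf : 'cV[R]_(d1 + d2) -> 'cV[R]_(d1 + d2))
    (M : 'cV[R]_d1 -> 'cV[R]_d2 -> 'M[R]_(d1, d2))
    (x : 'cV[R]_d1) (y : 'cV[R]_d2) : 'cV[R]_d1 :=
  usubmx (gf (col_mx x y)) + M x y *m dsubmx (gf (col_mx x y)).

Definition inner_step (gg : 'cV[R]_(d1 + d2) -> 'cV[R]_(d1 + d2)) (beta : R)
    (x : 'cV[R]_d1) (z : 'cV[R]_d2) : 'cV[R]_d2 :=
  z - beta *: dsubmx (gg (col_mx x z)).

(* [xs], [ys] are the iterates for rounds 1, ..., T.+1 (index 0 is unused);
   [gf], [gg] are the gradient fields of the outer and inner objectives. *)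
Definition is_OAGD (T : nat) (X : set 'cV[R]_d1)
    (gf gg : nat -> 'cV[R]_(d1 + d2) -> 'cV[R]_(d1 + d2))
    (M : nat -> 'cV[R]_d1 -> 'cV[R]_d2 -> 'M[R]_(d1, d2))
    (alpha beta : nat -> R) (K : nat -> nat)
    (xs : nat -> 'cV[R]_d1) (ys : nat -> 'cV[R]_d2) : Prop :=
  X (xs 1%N) /\
  forall t, (1 <= t <= T)%N ->
    ys t.+1 = iter (K t) (inner_step (gg t) (beta t) (xs t)) (ys t) /\
    xs t.+1 =
      proj X (xs t - alpha t *: hypergrad (gf t) (M t) (xs t) (ys t.+1)).

Definition BDReg (T : nat) (f g : nat -> 'cV[R]_(d1 + d2) -> R)
    (xs xopt : nat -> 'cV[R]_d1) : R :=
  \sum_(1 <= t < T.+1) (outer (f t) (g t) (xs t) - outer (f t) (g t) (xopt t)).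

Definition Plen (p T : nat) (xopt : nat -> 'cV[R]_d1) : R :=
  \sum_(2 <= t < T.+1) enorm (xopt t.-1 - xopt t) ^+ p.

Definition Ylen (p T : nat) (g : nat -> 'cV[R]_(d1 + d2) -> R)
    (xopt : nat -> 'cV[R]_d1) : R :=
  \sum_(2 <= t < T.+1)
    enorm (ystar (g t.-1) (xopt t.-1) - ystar (g t) (xopt t)) ^+ p.

Definition Slen (p T : nat) (g : nat -> 'cV[R]_(d1 + d2) -> R)
    (xopt : nat -> 'cV[R]_d1) : R :=
  Plen p T xopt + Ylen p T g xopt.

End Bilevel.

Section Constants.
Context {R : realType}.

Definition kappa (lg1 mug : R) : R := lg1 / mug.

Definition Ly (lg1 mug : R) : R := lg1 / mug.

Definition Mf (lf0 lf1 lg1 lg2 mug : R) : R :=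
  lf1 + lg1 * lf1 / mug + lf0 / mug * (lg2 + lg1 * lg2 / mug).

End Constants.

(* Main.v *)
Require Import Defs.
From mathcomp Require Import all_boot all_order all_algebra.
From mathcomp Require Import all_classical all_reals all_analysis.
From mathcomp Require Import ring lra zify.
Import Order.TTheory GRing.Theory Num.Theory.
Import numFieldNormedType.Exports.
Local Open Scope classical_set_scope.
Local Open Scope ring_scope.

(** The regret is controlled by two errors: the outer error, which is the distance
    from [xs t] to the minimiser [xopt t] of the round, and the inner error, which is
    the distance from [ys t.+1] to the inner solution [ystar (g t) (xs t)].

    The outer function [x |-> f (x, ystar x)] is strongly convex and has the
    hypergradient at [ystar x] as gradient relative to [X] ([outer_gradient]).
    This gradient is Lipschitz with constant [LF = 2 * Mf * Ly], because
    hypergradients are [Mf]-Lipschitz in both variables ([hypergrad_lip]) and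
    [ystar] is [Ly]-Lipschitz ([ystar_lip]). The step size satisfies
    [alpha * LF ^+ 2 <= muf / 32], so an exact projected gradient step contracts the
    distance to the minimiser by [1 - 63 / 64 * a] with [a = alpha * muf], and the
    inexact step adds at most [alpha * Mf] times the inner error ([outer_step]). The
    set [X] may have empty interior: gradients are then not unique, but only their
    pairings with directions inside [X] ever matter ([gradient_on_tangent]).

    The inner loop contracts by [(lg1 - mug) / (lg1 + mug)] per step
    ([gradient_step_contraction], from cocoercivity), hence by [r <= a / 2] over the
    [K] steps of a round ([inner_rate_le]). Between rounds its target moves by [Ly]
    times both outer errors plus the variation of the optimal inner solutions.

    The weighted sum of both errors, with weight [1 / (2 * Ly)] on the inner one,
    is therefore multiplied by at most [1 - a / 4] per round, up to twice the path
    variation ([lyapunov_step]). Summing this recursion bounds the sum of the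
    outer errors by the first-order path length, and Jensen's inequality bounds the
    sum of their squares by the second-order one ([tracking_sums]). The regret of a
    round is at most a multiple of the outer error, since [f] and [ystar] are
    Lipschitz ([outer_gap_lip]); by convexity it is also at most the squared gradient
    at the minimiser plus a multiple of the squared outer error
    ([outer_gap_gradient]). The two bounds of the minimum follow.

    The estimates use [a <= 1 / 32], which holds unless [X] is a single point
    ([alpha_muf_small]); in that case the regret vanishes. *)

Set Implicit Arguments.
Unset Strict Implicit.
Unset Printing Implicit Defensive.

(** * The Euclidean inner product and norm *)

Section EuclideanAlgebra.
Context {R : realType}.
Implicit Types (n m : nat).

Lemma dotC n (u v : 'cV[R]_n) : dot u v = dot v u.
Proof. by apply: eq_bigr => i _; rewrite mulrC. Qed.

Lemma dotDl n (u v w : 'cV[R]_n) : dot (u + v) w = dot u w + dot v w.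
Proof. by rewrite -big_split; apply: eq_bigr => i _; rewrite mxE mulrDl. Qed.

Lemma dotZl n a (u w : 'cV[R]_n) : dot (a *: u) w = a * dot u w.
Proof. by rewrite mulr_sumr; apply: eq_bigr => i _; rewrite mxE mulrA. Qed.

Lemma dotNl n (u w : 'cV[R]_n) : dot (- u) w = - dot u w.
Proof. by rewrite -scaleN1r dotZl mulN1r. Qed.

Lemma dotBl n (u v w : 'cV[R]_n) : dot (u - v) w = dot u w - dot v w.
Proof. by rewrite dotDl dotNl. Qed.

Lemma dotDr n (u v w : 'cV[R]_n) : dot w (u + v) = dot w u + dot w v.
Proof. by rewrite dotC dotDl !(dotC w). Qed.

Lemma dotZr n a (u w : 'cV[R]_n) : dot w (a *: u) = a * dot w u.
Proof. by rewrite dotC dotZl (dotC w). Qed.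

Lemma dotNr n (u w : 'cV[R]_n) : dot w (- u) = - dot w u.
Proof. by rewrite dotC dotNl (dotC w). Qed.

Definition dotE := (dotDl, dotDr, dotNl, dotNr, dotZl, dotZr).

Lemma dot0l n (w : 'cV[R]_n) : dot 0 w = 0.
Proof. by rewrite -(scale0r 0) dotZl mul0r. Qed.

Lemma dot0r n (w : 'cV[R]_n) : dot w 0 = 0.
Proof. by rewrite dotC dot0l. Qed.

Lemma dot_ge0 n (u : 'cV[R]_n) : 0 <= dot u u.
Proof. by apply: sumr_ge0 => i _; rewrite -expr2 sqr_ge0. Qed.

Lemma dot_eq0 n (u : 'cV[R]_n) : dot u u = 0 -> u = 0.
Proof.
move/eqP; rewrite psumr_eq0 => [/allP u0|i _]; last by rewrite -expr2 sqr_ge0.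
apply/matrixP => i j; rewrite ord1 mxE; apply/eqP.
by have := u0 i (mem_index_enum _); rewrite /= -expr2 sqrf_eq0.
Qed.

Lemma enorm_ge0 n (u : 'cV[R]_n) : 0 <= enorm u.
Proof. exact: sqrtr_ge0. Qed.

Lemma enorm_sq n (u : 'cV[R]_n) : enorm u ^+ 2 = dot u u.
Proof. by rewrite sqr_sqrtr ?dot_ge0. Qed.

Lemma enorm0 n : enorm (0 : 'cV[R]_n) = 0.
Proof. by rewrite /enorm dot0l sqrtr0. Qed.

Lemma enorm_eq0 n (u : 'cV[R]_n) : enorm u = 0 -> u = 0.
Proof. by move=> u0; apply: dot_eq0; rewrite -enorm_sq u0 expr0n. Qed.

Lemma enormZ n a (u : 'cV[R]_n) : enorm (a *: u) = `|a| * enorm u.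
Proof.
by rewrite /enorm dotZl dotZr mulrA -expr2 sqrtrM ?sqr_ge0// sqrtr_sqr.
Qed.

Lemma enormN n (u : 'cV[R]_n) : enorm (- u) = enorm u.
Proof. by rewrite -scaleN1r enormZ normrN1 mul1r. Qed.

Lemma enormBC n (u v : 'cV[R]_n) : enorm (u - v) = enorm (v - u).
Proof. by rewrite -enormN opprB. Qed.

Lemma enorm_le n (u : 'cV[R]_n) (c : R) :
  0 <= c -> dot u u <= c ^+ 2 -> enorm u <= c.
Proof.
by move=> c0 uc; rewrite -(ler_pXn2r (ltn0Sn 1)) ?nnegrE ?enorm_ge0// enorm_sq.
Qed.

Lemma CauchySchwarz n (u v : 'cV[R]_n) : `|dot u v| <= enorm u * enorm v.
Proof.
rewrite -(ler_pXn2r (ltn0Sn 1)) ?nnegrE ?mulr_ge0 ?enorm_ge0//.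
rewrite real_normK ?num_real// exprMn !enorm_sq.
have [v0|v0] := eqVneq (dot v v) 0.
  by rewrite (dot_eq0 v0) !dot0r mulr0 expr0n.
have vp : 0 < dot v v by rewrite lt_neqAle eq_sym v0 dot_ge0.
have := dot_ge0 (dot v v *: u - dot u v *: v).
rewrite !dotE (dotC v u) => H; rewrite -(ler_pM2l vp); nra.
Qed.

Lemma dot_le n (u v : 'cV[R]_n) : dot u v <= enorm u * enorm v.
Proof. exact: le_trans (ler_norm _) (CauchySchwarz _ _). Qed.

Lemma enormD n (u v : 'cV[R]_n) : enorm (u + v) <= enorm u + enorm v.
Proof.
apply: enorm_le; first by rewrite addr_ge0 ?enorm_ge0.
rewrite !dotE (dotC v u) -!enorm_sq; have := dot_le u v; nra.
Qed.

Lemma enormB n (u v : 'cV[R]_n) : enorm (u - v) <= enorm u + enorm v.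
Proof. by rewrite -(enormN v) enormD. Qed.

Lemma enorm_dist n (w u v : 'cV[R]_n) :
  enorm (u - v) <= enorm (u - w) + enorm (w - v).
Proof. have -> : u - v = (u - w) + (w - v) by rewrite addrA subrK.
exact: enormD. Qed.

Lemma dot_col_mx n m (a c : 'cV[R]_n) (b d : 'cV[R]_m) :
  dot (col_mx a b) (col_mx c d) = dot a c + dot b d.
Proof.
rewrite /dot big_split_ord; congr (_ + _); apply: eq_bigr => i _.
  by rewrite !col_mxEu.
by rewrite !col_mxEd.
Qed.

Lemma dot_col_mxr n m (z : 'cV[R]_(n + m)) (c : 'cV[R]_n) (d : 'cV[R]_m) :
  dot z (col_mx c d) = dot (usubmx z) c + dot (dsubmx z) d.
Proof. by rewrite -{1}(vsubmxK z) dot_col_mx. Qed.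

Lemma enorm_col0 n m (b : 'cV[R]_m) : enorm (col_mx (0 : 'cV[R]_n) b) = enorm b.
Proof. by rewrite /enorm dot_col_mx dot0l add0r. Qed.

Lemma enorm_col_le n m (a : 'cV[R]_n) (b : 'cV[R]_m) :
  enorm (col_mx a b) <= enorm a + enorm b.
Proof.
apply: enorm_le; first by rewrite addr_ge0 ?enorm_ge0.
rewrite dot_col_mx -!enorm_sq; have := enorm_ge0 a; have := enorm_ge0 b; nra.
Qed.

Lemma enorm_usub n m (z : 'cV[R]_(n + m)) : enorm (usubmx z) <= enorm z.
Proof.
apply: enorm_le; first exact: enorm_ge0.
by rewrite enorm_sq -{3 4}(vsubmxK z) dot_col_mx lerDl dot_ge0.
Qed.

Lemma enorm_dsub n m (z : 'cV[R]_(n + m)) : enorm (dsubmx z) <= enorm z.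
Proof.
apply: enorm_le; first exact: enorm_ge0.
by rewrite enorm_sq -{3 4}(vsubmxK z) dot_col_mx lerDr dot_ge0.
Qed.

Lemma abs_coord_le n (u : 'cV[R]_n) i : `|u i 0| <= enorm u.
Proof.
rewrite -(ler_pXn2r (ltn0Sn 1)) ?nnegrE ?enorm_ge0// enorm_sq /dot.
rewrite (bigD1 i)//= real_normK ?num_real// expr2 lerDl.
by apply: sumr_ge0 => j _; rewrite -expr2 sqr_ge0.
Qed.

Lemma enorm_le_coord n (u : 'cV[R]_n) (c : R) :
  0 <= c -> (forall i, `|u i 0| <= c) -> enorm u <= n%:R * c.
Proof.
move=> c0 uc; apply: enorm_le; first by rewrite mulr_ge0.
apply: (@le_trans _ _ (n%:R * c ^+ 2)).
  rewrite mulr_natl -[n in leRHS]card_ord -sumr_const; apply: ler_sum => i _.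
  rewrite -expr2 -(real_normK (num_real (u i 0))).
  by rewrite ler_pXn2r// nnegrE.
rewrite exprMn ler_wpM2r ?sqr_ge0//.
by case: (n) => [|k]; rewrite ?expr0n// expr2 ler_peMl// ler1n.
Qed.

(** The topology of matrices is given by the sup norm of the coordinates, which is
    at most the Euclidean norm; conversely the latter is at most [n] times the
    former. So neighbourhoods may be tested on Euclidean balls. The radius below
    uses [n.+1] to stay meaningful in dimension zero. *)
Lemma near_within_enorm n (A P : set 'cV[R]_n) (z : 'cV[R]_n) :
  (\forall z' \near within A (nbhs z), P z') <->
  exists2 d : R, 0 < d & forall z', A z' -> enorm (z' - z) < d -> P z'.
Proof.
rewrite near_withinE; split.
  move/nbhs_ballP => [d /= d0 dP]; exists d => // z' Az' z'd.
  apply: dP => //=; split=> // i j; rewrite (ord1 j) /ball /= distrC.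
  by apply: le_lt_trans z'd; have := abs_coord_le (z' - z) i; rewrite !mxE.
move=> [d d0 dP]; apply/nbhs_ballP.
exists (d / (2 * n.+1%:R)) => /=; first by rewrite divr_gt0 ?mulr_gt0.
move=> z' [_ zz'] Az'; apply: dP => //.
have e0 : 0 <= d / (2 * n.+1%:R) by rewrite divr_ge0 ?mulr_ge0// ltW.
apply: (@le_lt_trans _ _ (n%:R * (d / (2 * n.+1%:R)))).
  apply: enorm_le_coord => // i; rewrite !mxE distrC ltW//.
  exact: zz'.
rewrite mulrA ltr_pdivrMr ?mulr_gt0// mulrC ltr_pM2l//.
by rewrite -natrM ltr_nat; lia.
Qed.

End EuclideanAlgebra.
(** * Relative gradients: mean values and symmetric Hessians *)

Section Differentiation.
Context {R : realType}.
Implicit Types (n m : nat).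

Lemma is_gradient_onP n (A : set 'cV[R]_n) h z v :
  is_gradient_on A h z v <->
  forall e : R, 0 < e -> exists2 d : R, 0 < d &
    forall z', A z' -> enorm (z' - z) < d ->
      `|h z' - h z - dot v (z' - z)| <= e * enorm (z' - z).
Proof. by split=> H e /H /near_within_enorm. Qed.

Lemma is_jacobian_onP m n (A : set 'cV[R]_n) (G : 'cV[R]_n -> 'cV[R]_m) z J :
  is_jacobian_on A G z J <->
  forall e : R, 0 < e -> exists2 d : R, 0 < d &
    forall z', A z' -> enorm (z' - z) < d ->
      enorm (G z' - G z - J *m (z' - z)) <= e * enorm (z' - z).
Proof. by split=> H e /H /near_within_enorm. Qed.

(** All uses of a relative gradient are along segments inside [A]; the constant
    [enorm w] is absorbed once and for all in the radius. *)
Lemma is_gradient_on_dir n (A : set 'cV[R]_n) h z v w (e : R) :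
  is_gradient_on A h z v -> 0 < e ->
  exists2 d : R, 0 < d & forall s, A (z + s *: w) -> `|s| < d ->
    `|h (z + s *: w) - h z - s * dot v w| <= e * `|s|.
Proof.
have w1 : 0 < enorm w + 1 by rewrite ltr_wpDl ?enorm_ge0.
move=> /is_gradient_onP H e0; have [d d0 dH] := H _ (divr_gt0 e0 w1).
exists (d / (enorm w + 1)); first by rewrite divr_gt0.
move=> s As sd; have := dH _ As; rewrite addrAC subrr add0r dotZr enormZ.
have sw : `|s| * enorm w <= `|s| * (enorm w + 1).
  by rewrite ler_wpM2l// lerDl.
move=> /(_ _)/le_trans; apply.
  by apply: le_lt_trans sw _; rewrite -ltr_pdivlMr.
apply: (@le_trans _ _ (e / (enorm w + 1) * (`|s| * (enorm w + 1)))).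
  by rewrite ler_wpM2l// divr_ge0 // ltW.
by rewrite mulrCA divfK ?gt_eqF// mulrC.
Qed.

(** The gradients are only relative to [A], but inside the segment a small motion in
    either direction stays in [A], so the restriction to the segment is a
    function of one real variable to which the mean value theorem applies. *)
Lemma segment_MVT n (A : set 'cV[R]_n) h (G : 'cV[R]_n -> 'cV[R]_n) z w :
  (forall s, 0 <= s <= 1 -> A (z + s *: w)) ->
  (forall s, 0 <= s <= 1 -> is_gradient_on A h (z + s *: w) (G (z + s *: w))) ->
  exists2 s, 0 <= s <= 1 & h (z + w) - h z = dot (G (z + s *: w)) w.
Proof.
move=> Aw Gw; pose phi (s : R) := h (z + s *: w).
have key s e : 0 <= s <= 1 -> 0 < e -> exists2 d : R, 0 < d &
    forall t, 0 <= t <= 1 -> `|t - s| < d ->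
    `|phi t - phi s - (t - s) * dot (G (z + s *: w)) w| <= e * `|t - s|.
  move=> s01 e0; have [d d0 dH] := is_gradient_on_dir w (Gw s s01) e0.
  exists d => // t t01 td.
  have tE : z + t *: w = z + s *: w + (t - s) *: w.
    by rewrite -addrA -scalerDl subrKC.
  by have := dH (t - s); rewrite -tE /phi => ->//; exact: Aw.
have [|||s] := @MVT_segment R phi (fun s => dot (G (z + s *: w)) w) 0 1.
- exact: ler01.
- move=> s; rewrite in_itv /= => /andP[s0 s1].
  suff cv : (fun t : R => t^-1 *: ((phi \o shift s) (t *: (1:R)) - phi s)) @ 0^'
      --> dot (G (z + s *: w)) w.
    by apply: DeriveDef; [apply/cvg_ex; eexists; exact: cv | exact: cvg_lim].
  apply/cvgrPdist_le => e e0.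
  have [|d d0 dH] := key s e _ e0; first by rewrite !ltW.
  have m0 : 0 < Num.min d (Num.min s (1 - s)) by rewrite !lt_min d0 s0 subr_gt0 s1.
  apply/nbhs_ballP; exists (Num.min d (Num.min s (1 - s))) => //= t.
  rewrite /ball /= sub0r normrN !lt_min => /and3P[td ts ts'] t0.
  have nt0 : 0 < `|t| by rewrite normr_gt0.
  have := dH (t + s); rewrite addrK => H.
  have {}H : `|phi (t + s) - phi s - t * dot (G (z + s *: w)) w| <= e * `|t|.
    apply: H => //; apply/andP; split.
      by have := ler_normr t (- t); have := ler_norm (- t); rewrite normrN; lra.
    by have := ler_norm t; lra.
  rewrite -[leLHS](mulfK (lt0r_neq0 nt0)) ler_pdivrMr// -normrM.
  rewrite mulrBl /= /GRing.scale /= mulr1 mulrAC mulVf// mul1r.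
  by rewrite -normrN opprB [dot _ _ * _]mulrC.
- apply/subspace_continuousP => s; rewrite /= in_itv /= => s01.
  apply/cvgrPdist_le => e e0.
  have [d d0 dH] := key s 1 s01 ltr01.
  pose c := 1 + `|dot (G (z + s *: w)) w|.
  have c0 : 0 < c by rewrite ltr_wpDr.
  rewrite near_withinE; apply/nbhs_ballP.
  exists (Num.min d (e / c)) => /=; first by rewrite lt_min d0 divr_gt0.
  move=> t; rewrite /ball /= lt_min distrC => /andP[td tc]; rewrite in_itv /= => t01.
  rewrite distrC; have := dH t t01 td; rewrite mul1r => H.
  rewrite -[phi t - _](subrK ((t - s) * dot (G (z + s *: w)) w)).
  apply: le_trans (ler_normD _ _) _; rewrite normrM.
  apply: (@le_trans _ _ (`|t - s| * c)).
    by rewrite /c mulrDr mulr1 lerD2r.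
  by rewrite -ler_pdivlMr// ltW.
rewrite in_itv /= => s01; rewrite /phi scale1r scale0r addr0 subr0 mulr1 => E.
by exists s.
Qed.

Lemma is_gradient_onD n (A : set 'cV[R]_n) h k z v w :
  is_gradient_on A h z v -> is_gradient_on A k z w ->
  is_gradient_on A (fun u => h u + k u) z (v + w).
Proof.
move=> /is_gradient_onP Hh /is_gradient_onP Hk; apply/is_gradient_onP => e e0.
have e2 : 0 < e / 2 by rewrite divr_gt0.
have [d d0 dH] := Hh _ e2; have [d' d'0 d'H] := Hk _ e2.
exists (Num.min d d'); first by rewrite lt_min d0.
move=> z' Az'; rewrite lt_min => /andP[/(dH _ Az') H1 /(d'H _ Az') H2].
rewrite dotDl; have -> : h z' + k z' - (h z + k z) - (dot v (z' - z) + dot w (z' - z))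
   = (h z' - h z - dot v (z' - z)) + (k z' - k z - dot w (z' - z)) by ring.
by apply: le_trans (ler_normD _ _) _; lra.
Qed.

Lemma is_gradient_onN n (A : set 'cV[R]_n) h z v :
  is_gradient_on A h z v -> is_gradient_on A (fun u => - h u) z (- v).
Proof.
move=> /is_gradient_onP Hh; apply/is_gradient_onP => e /Hh[d d0 dH].
exists d => // z' Az' /(dH _ Az'); rewrite dotNl => H.
by rewrite -normrN !opprD !opprK.
Qed.

Lemma is_gradient_on_shift n (A : set 'cV[R]_n) h z v w :
  is_gradient_on A h (z + w) v ->
  is_gradient_on [set u | A (u + w)] (fun u => h (u + w)) z v.
Proof.
move=> /is_gradient_onP Hh; apply/is_gradient_onP => e /Hh[d d0 dH].
exists d => // z' Az' z'd.
have E : z' + w - (z + w) = z' - z by rewrite opprD addrACA subrr addr0.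
by have := dH _ Az'; rewrite E; exact.
Qed.

Lemma is_gradient_on_sub n (A B : set 'cV[R]_n) h z v :
  B `<=` A -> is_gradient_on A h z v -> is_gradient_on B h z v.
Proof.
move=> BA /is_gradient_onP Hh; apply/is_gradient_onP => e /Hh[d d0 dH].
by exists d => // z' Bz'; apply/dH/BA.
Qed.

Lemma is_gradient_on_sqdist n (A : set 'cV[R]_n) (c : R) y z :
  is_gradient_on A (fun u => c * enorm (u - y) ^+ 2) z ((2 * c) *: (z - y)).
Proof.
apply/is_gradient_onP => e e0; have c0 : 0 < `|c| + 1 by rewrite ltr_wpDl.
exists (e / (`|c| + 1)); first by rewrite divr_gt0.
move=> z' _ z'd.
have -> : c * enorm (z' - y) ^+ 2 - c * enorm (z - y) ^+ 2 -
    dot ((2 * c) *: (z - y)) (z' - z) = c * enorm (z' - z) ^+ 2.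
  rewrite !enorm_sq !dotE (dotC z z') (dotC y z') (dotC y z); ring.
rewrite normrM (ger0_norm (sqr_ge0 _)) expr2 mulrA ler_wpM2r ?enorm_ge0//.
apply: (@le_trans _ _ ((`|c| + 1) * enorm (z' - z))).
  by rewrite ler_wpM2r ?enorm_ge0// lerDl.
by rewrite mulrC -ler_pdivlMr// ltW.
Qed.

(** Applying the mean value theorem along [s *: b] to the difference
    [u |-> h (u + s *: a) - h u], whose gradient increment is controlled by the
    Jacobian [H] of the gradient at [z], isolates the bilinear term. *)
Lemma second_difference n (A : set 'cV[R]_n) h G z (H : 'M[R]_n) a b (e : R) :
  (forall s t, 0 <= s <= 1 -> 0 <= t <= 1 -> A (z + s *: a + t *: b)) ->
  (forall u, A u -> is_gradient_on A h u (G u)) ->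
  is_jacobian_on A G z H -> 0 < e ->
  exists2 d : R, 0 < d & forall s, 0 < s <= 1 -> s < d ->
    `|h (z + s *: a + s *: b) - h (z + s *: b) - h (z + s *: a) + h z
      - s ^+ 2 * dot (H *m a) b|
    <= 2 * e * s ^+ 2 * (enorm a + enorm b + 1) ^+ 2.
Proof.
move=> PA HG /is_jacobian_onP HJ e0.
set c := enorm a + enorm b + 1.
have na := enorm_ge0 a; have nb := enorm_ge0 b.
have c0 : 0 < c by rewrite ltr_wpDl ?addr_ge0.
have bc : enorm b <= c by rewrite /c; lra.
have abc : enorm a + enorm b <= c by rewrite lerDl.
have [d d0 dH] := HJ e e0.
exists (d / c); first by rewrite divr_gt0.
move=> s /andP[s0 s1] sd.
pose A' := [set u | A (u + s *: a)] `&` A.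
pose k u := h (u + s *: a) - h u.
have r01 (r : R) : 0 <= r <= 1 -> 0 <= r * s <= 1.
  by move=> /andP[r0 r1]; rewrite mulr_ge0 ?(ltW s0)//= mulr_ile1// ltW.
have s01 : 0 <= s <= 1 by rewrite ltW.
have A1 (r : R) : 0 <= r <= 1 -> A (z + r *: (s *: b) + s *: a).
  by move=> /r01 rs; rewrite scalerA addrAC; exact: PA.
have A2 (r : R) : 0 <= r <= 1 -> A (z + r *: (s *: b)).
  move=> /r01 rs; have := @PA 0 (r * s); rewrite scale0r addr0 scalerA; apply => //.
  by rewrite lexx ler01.
have [||r r1 kE] := @segment_MVT _ A' k (fun u => G (u + s *: a) - G u) z (s *: b).
- by move=> r r1; split; [exact: A1|exact: A2].
- move=> r r1; apply: is_gradient_onD.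
    apply: is_gradient_on_sub (is_gradient_on_shift (HG _ (A1 _ r1))).
    by move=> u [].
  apply: is_gradient_on_sub (is_gradient_onN (HG _ (A2 _ r1))).
  by move=> u [].
have := r01 _ r1 => /andP[rs0 rs1].
have -> : h (z + s *: a + s *: b) - h (z + s *: b) - h (z + s *: a) + h z
    = k (z + s *: b) - k z.
  by rewrite /k (addrAC z); ring.
rewrite kE.
have n1 : enorm (z + r *: (s *: b) + s *: a - z) <= s * c.
  rewrite addrAC [z + _ - z]addrAC subrr add0r scalerA; apply: le_trans (enormD _ _) _.
  rewrite !enormZ !ger0_norm// ?(ltW s0)//.
  apply: (@le_trans _ _ (s * enorm b + s * enorm a)).
    rewrite lerD2r ler_wpM2r// -[leRHS]mul1r ler_wpM2r ?(ltW s0)//.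
    by case/andP: r1.
  by rewrite -mulrDr ler_wpM2l ?(ltW s0)// addrC.
have n2 : enorm (z + r *: (s *: b) - z) <= s * c.
  rewrite addrAC subrr add0r scalerA enormZ ger0_norm//.
  apply: ler_pM => //.
  by rewrite -[leRHS]mul1r ler_wpM2r ?(ltW s0)//; case/andP: r1.
have sc : s * c < d by rewrite -ltr_pdivlMr.
have e1 := dH _ (A1 _ r1) (le_lt_trans n1 sc).
have e2 := dH _ (A2 _ r1) (le_lt_trans n2 sc).
set u1 := z + r *: _ + _ in e1 n1 *; set u2 := z + _ in e2 n2 *.
have dE : dot (G u1 - G u2) (s *: b) - s ^+ 2 * dot (H *m a) b
   = s * (dot (G u1 - G z - H *m (u1 - z)) b - dot (G u2 - G z - H *m (u2 - z)) b).
  have -> : u1 - z = (u2 - z) + s *: a by rewrite /u1 -/u2 addrAC.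
  by rewrite mulmxDr -scalemxAr !dotE; ring.
rewrite dE normrM (ger0_norm (ltW s0)).
have bound w : enorm (G w - G z - H *m (w - z)) <= e * enorm (w - z) ->
    enorm (w - z) <= s * c ->
    `|dot (G w - G z - H *m (w - z)) b| <= e * s * c ^+ 2.
  move=> ew wc; apply: le_trans (CauchySchwarz _ _) _.
  rewrite expr2 mulrA; apply: ler_pM => //; try exact: enorm_ge0.
  by apply: le_trans ew _; rewrite -mulrA ler_wpM2l// ltW.
have -> : 2 * e * s ^+ 2 * c ^+ 2 = s * (2 * (e * s * c ^+ 2)) by ring.
rewrite ler_wpM2l ?(ltW s0)//; apply: le_trans (ler_normB _ _) _.
by rewrite mulr_natl mulr2n lerD// bound.
Qed.

(** Schwarz's theorem, relative to [A]: the second difference of [h] over the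
    parallelogram spanned by [s *: a] and [s *: b] does not depend on which side
    comes first, so its two expansions have the same coefficient of [s ^+ 2]. *)
Lemma jacobian_symmetric n (A : set 'cV[R]_n) h G z (H : 'M[R]_n) a b :
  (forall s t, 0 <= s <= 1 -> 0 <= t <= 1 -> A (z + s *: a + t *: b)) ->
  (forall u, A u -> is_gradient_on A h u (G u)) ->
  is_jacobian_on A G z H ->
  dot (H *m a) b = dot (H *m b) a.
Proof.
move=> PA HG HJ; set c := enorm a + enorm b + 1.
have c0 : 0 < c by rewrite ltr_wpDl ?addr_ge0 ?enorm_ge0.
have PA' s t : 0 <= s <= 1 -> 0 <= t <= 1 -> A (z + s *: b + t *: a).
  by move=> s1 t1; rewrite addrAC; exact: PA.
apply/eqP; rewrite -subr_eq0 -normr_le0; apply/ler_addgt0Pl => e e0.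
rewrite addr0.
have e0' : 0 < e / (4 * c ^+ 2) by rewrite divr_gt0 ?mulr_gt0 ?exprn_gt0.
have [d d0 dH] := second_difference PA HG HJ e0'.
have [d' d'0 d'H] := second_difference PA' HG HJ e0'.
pose s := Num.min 1 (Num.min d d') / 2.
have m0 : 0 < Num.min 1 (Num.min d d') by rewrite !lt_min ltr01 d0.
have s0 : 0 < s by rewrite divr_gt0.
have sm : s < Num.min 1 (Num.min d d') by rewrite /s; lra.
move: (sm); rewrite !lt_min => /and3P[s1 sd sd'].
have s01 : 0 < s <= 1 by rewrite s0 ltW.
have H1 := dH _ s01 sd; have H2 := d'H _ s01 sd'.
have cE : 2 * (e / (4 * c ^+ 2)) * s ^+ 2 * c ^+ 2 = s ^+ 2 * (e / 2).
  by field; rewrite gt_eqF.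
rewrite (addrC (enorm b)) in H2; rewrite -/c !cE in H1 H2.
have s20 : 0 < s ^+ 2 by rewrite exprn_gt0.
rewrite -(ler_pM2l s20) -{1}(ger0_norm (ltW s20)) -normrM.
move: H1 H2; rewrite (addrAC z (s *: b)) !ler_norml => /andP[? ?] /andP[? ?].
by apply/andP; split; lra.
Qed.

End Differentiation.
(** * Strong convexity, gradient descent and minimisers *)

Section Convexity.
Context {R : realType}.
Implicit Types (n m : nat).

Definition segment_closed n (A : set 'cV[R]_n) : Prop :=
  forall u v (s : R), A u -> A v -> 0 <= s <= 1 -> A (u + s *: (v - u)).

Lemma segment_closedT n : segment_closed (@setT 'cV[R]_n).
Proof. by []. Qed.

(** Divide the convexity inequality at [z + l *: (u - z)] by [l] and let [l] tend
    to [0]. *)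
Lemma strongly_convex_gradient n (A : set 'cV[R]_n) mu h z u v :
  segment_closed A -> strongly_convex_on A mu h -> A z -> A u ->
  is_gradient_on A h z v ->
  dot v (u - z) <= h u - h z - mu / 2 * enorm (u - z) ^+ 2.
Proof.
move=> cA ch Az Au Hv; set m := mu / 2 * _; apply/ler_addgt0Pr => e e0.
have e2 : 0 < e / 2 by rewrite divr_gt0.
have [d d0 dH] := is_gradient_on_dir (u - z) Hv e2.
pose M := `|m| + 1; have M0 : 0 < M by rewrite ltr_wpDl.
pose q := Num.min 1 (Num.min d (e / 2 / M)).
have q0 : 0 < q by rewrite !lt_min ltr01 d0 divr_gt0.
pose l := q / 2; have l0 : 0 < l by rewrite divr_gt0.
have : l < q by rewrite /l; lra.
rewrite !lt_min => /and3P[l1 ld lM].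
have l01 : 0 <= l <= 1 by rewrite !ltW.
have := dH l (cA _ _ _ Az Au l01); rewrite (gtr0_norm l0) => /(_ ld).
rewrite ler_norml => /andP[H _].
have zE : z + l *: (u - z) = l *: u + (1 - l) *: z.
  by rewrite scalerBr scalerBl scale1r addrCA addrA.
have := ch u z l Au Az l01; rewrite -zE => H2.
have H3 : mu / 2 * l * (1 - l) * enorm (u - z) ^+ 2 = l * ((1 - l) * m).
  by rewrite /m; ring.
rewrite H3 in H2.
have H4 : m * l <= e / 2.
  apply: (@le_trans _ _ (M * l)); last by rewrite mulrC -ler_pdivlMr// ltW.
  by rewrite ler_wpM2r ?ltW// /M; have := ler_norm m; lra.
rewrite -(ler_pM2l l0); clear -l0 H H2 H4; nra.
Qed.

Lemma argmin_gradient n (A : set 'cV[R]_n) h z u v :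
  segment_closed A -> argmin_set A h z -> A u -> is_gradient_on A h z v ->
  0 <= dot v (u - z).
Proof.
move=> cA [Az hz] Au Hv; apply/ler_addgt0Pr => e e0.
have [d d0 dH] := is_gradient_on_dir (u - z) Hv e0.
pose q := Num.min 1 d; have q0 : 0 < q by rewrite lt_min ltr01.
pose l := q / 2; have l0 : 0 < l by rewrite divr_gt0.
have : l < q by rewrite /l; lra.
rewrite !lt_min => /andP[l1 ld].
have Al : A (z + l *: (u - z)) by apply: cA => //; rewrite !ltW.
have := dH l Al; rewrite (gtr0_norm l0) => /(_ ld).
rewrite ler_norml => /andP[_ H]; have := hz _ Al => H2.
by rewrite -(ler_pM2l l0); nra.
Qed.

Lemma argmin_gradientT n (h : 'cV[R]_n -> R) z v :
  argmin_set setT h z -> is_gradient_on setT h z v -> v = 0.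
Proof.
move=> hz Hv; apply: dot_eq0; apply/eqP; rewrite eq_le dot_ge0 andbT.
have := argmin_gradient (u := z - v) (@segment_closedT n) hz I Hv.
by rewrite addrAC subrr add0r dotNr oppr_ge0.
Qed.

(** A relative gradient is not unique when [A] is flat, but its pairing with a
    direction that stays in [A] is a one-sided directional derivative, hence does
    not depend on the choice made by [gradient_on]. *)
Lemma gradient_on_tangent n (A : set 'cV[R]_n) h z u v :
  segment_closed A -> A z -> A u -> is_gradient_on A h z v ->
  dot (gradient_on A h z) (u - z) = dot v (u - z).
Proof.
move=> cA Az Au Hv.
have Hw : is_gradient_on A h z (gradient_on A h z).
  by apply: (@getPex _ [set v | is_gradient_on A h z v]); exists v.
apply/eqP; rewrite -subr_eq0 -normr_le0; apply/ler_addgt0Pl => e e0.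
rewrite addr0; have e2 : 0 < e / 2 by rewrite divr_gt0.
have [d d0 dH] := is_gradient_on_dir (u - z) Hv e2.
have [d' d'0 d'H] := is_gradient_on_dir (u - z) Hw e2.
pose q := Num.min 1 (Num.min d d').
have q0 : 0 < q by rewrite !lt_min ltr01 d0.
pose l := q / 2; have l0 : 0 < l by rewrite divr_gt0.
have : l < q by rewrite /l; lra.
rewrite !lt_min => /and3P[l1 ld ld'].
have Al : A (z + l *: (u - z)) by apply: cA => //; rewrite !ltW.
rewrite -(ler_pM2l l0) -{1}(gtr0_norm l0) -normrM.
have := dH l Al; have := d'H l Al; rewrite (gtr0_norm l0) => /(_ ld') + /(_ ld).
by rewrite !ler_norml =>  /andP[? ?] /andP[? ?]; apply/andP; split; lra.
Qed.

(** Mean value theorem for [h - L / 2 |. - y|^2], whose gradient pairs with the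
    increment to at most [dot (G y) w]. *)
Lemma descent n (h : 'cV[R]_n -> R) (G : 'cV[R]_n -> 'cV[R]_n) (L : R) y w :
  (forall u, is_gradient_on setT h u (G u)) ->
  (forall u u', enorm (G u - G u') <= L * enorm (u - u')) ->
  h (y + w) <= h y + dot (G y) w + L / 2 * enorm w ^+ 2.
Proof.
move=> HG HL; pose k u := h u + - (L / 2) * enorm (u - y) ^+ 2.
have [//||s /andP[s0 s1]] := @segment_MVT _ _ setT k
    (fun u => G u + (2 * - (L / 2)) *: (u - y)) y w.
  by move=> s _; apply: is_gradient_onD => //; exact: is_gradient_on_sqdist.
have -> : 2 * - (L / 2) = - L by field.
rewrite /k subrr enorm0 expr0n mulr0 addr0.
have E : y + s *: w - y = s *: w by rewrite addrAC subrr add0r.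
have E1 : y + w - y = w by rewrite addrAC subrr add0r.
rewrite E E1 !dotE -(enorm_sq w) => H.
have H1 := dot_le (G (y + s *: w) - G y) w.
have H2 := HL (y + s *: w) y; rewrite E enormZ (ger0_norm s0) in H2.
have H3 := ler_wpM2r (enorm_ge0 w) H2.
by move: H1; rewrite dotBl; nra.
Qed.

(** The Baillon-Haddad inequality for [h - mu / 2 |.|^2], which is convex with
    curvature at most [L - mu]. Put [q] for the difference of the gradients of
    that function. Each of the two points is compared with the point at [s *: q]
    from the other one, from above by the descent inequality and from below by
    convexity; adding both gives a quadratic inequality in [s], whose best choice
    is the inverse of [L - mu]. *)
Lemma cocoercive n (h : 'cV[R]_n -> R) (G : 'cV[R]_n -> 'cV[R]_n) (mu L : R) y y' :
  strongly_convex_on setT mu h ->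
  (forall u, is_gradient_on setT h u (G u)) ->
  (forall u u', enorm (G u - G u') <= L * enorm (u - u')) ->
  enorm (G y - G y') ^+ 2 + L * mu * enorm (y - y') ^+ 2 <=
    (L + mu) * dot (G y - G y') (y - y').
Proof.
move=> ch HG HL.
pose q := G y - G y' - mu *: (y - y').
have half x x' (s : R) : h x' - h x + dot (G x') (x - x')
    + mu / 2 * dot (x - x') (x - x') <=
    ((L - mu) / 2 * s ^+ 2 - s) *
    dot (G x - G x' - mu *: (x - x')) (G x - G x' - mu *: (x - x')).
  set p := G x - _ - _.
  have D := descent x (- (s *: p)) HG HL.
  have C := strongly_convex_gradient (u := x + - (s *: p)) (@segment_closedT n)
    ch I I (HG x').
  have E : x - s *: p - x' = (x - x') - s *: p by rewrite addrAC.
  have P : dot p p = dot (G x) p - dot (G x') p - mu * dot (x - x') p.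
    by rewrite {1}/p dotBl dotBl dotZl.
  move: D C; rewrite E; clearbody p; move: P; set e := x - x'.
  clearbody e; rewrite !enorm_sq !dotE (dotC p e) => P D C; clear -P D C; nra.
have H s : dot (G y - G y') (y - y') - mu * dot (y - y') (y - y') >=
    (2 * s - (L - mu) * s ^+ 2) * dot q q.
  have H1 := half y y' s; have := half y' y s.
  have -> : G y' - G y - mu *: (y' - y) = - q.
    have -> : y' - y = - (y - y') by rewrite opprB.
    by rewrite scalerN opprK /q; set X := mu *: _; rewrite !opprB addrC.
  rewrite -/q in H1 *; rewrite -[y' - y]opprB !dotNr !dotNl !opprK => H2.
  rewrite dotBl; lra.
have Q : dot q q = dot (G y - G y') (G y - G y') - 2 * mu * dot (G y - G y') (y - y')
   + mu ^+ 2 * dot (y - y') (y - y').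
  rewrite /q; move: (G y - G y') (y - y') => b e; rewrite !dotE (dotC e b); ring.
suff S : dot q q <= (L - mu) *
   (dot (G y - G y') (y - y') - mu * dot (y - y') (y - y')).
  rewrite !enorm_sq; move: S; rewrite Q; lra.
have cE : dot (G y - G y') (y - y') - mu * dot (y - y') (y - y') = dot q (y - y').
  by rewrite /q [RHS]dotBl dotZl.
rewrite cE in H *; have q0 := dot_ge0 q; set c := dot q (y - y') in H *.
have [l0|l0] := ltrP 0 (L - mu).
  have := H (L - mu)^-1.
  have -> : 2 * (L - mu)^-1 - (L - mu) * (L - mu)^-1 ^+ 2 = (L - mu)^-1.
    by field; rewrite gt_eqF.
  by rewrite mulrC ler_pdivrMr// mulrC.
(* without curvature gap the bound is linear in [s], which forces [q = 0] *)
suff q00 : q = 0 by rewrite /c q00 !dot0l mulr0.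
apply: dot_eq0; apply/eqP; rewrite eq_le q0 andbT leNgt; apply/negP => qp.
have := H ((`|c| + 1) / (2 * dot q q)).
rewrite mulrBl; set s := _ / _.
have -> : 2 * s * dot q q = `|c| + 1 by rewrite /s; field; rewrite gt_eqF.
have l0' : 0 <= mu - L by rewrite -oppr_le0 opprB.
have := ler_norm c; have := mulr_ge0 (mulr_ge0 l0' (sqr_ge0 s)) q0; lra.
Qed.

Lemma strong_convexity_le_smoothness n (h : 'cV[R]_n -> R) (G : 'cV[R]_n -> 'cV[R]_n)
    (mu L : R) :
  (0 < n)%N -> strongly_convex_on setT mu h ->
  (forall u, is_gradient_on setT h u (G u)) ->
  (forall u u', enorm (G u - G u') <= L * enorm (u - u')) -> mu <= L.
Proof.
move=> n0 ch HG HL; pose w : 'cV[R]_n := const_mx 1.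
have w0 : 0 < enorm w ^+ 2.
  rewrite enorm_sq lt_neqAle dot_ge0 andbT eq_sym; apply/eqP => /dot_eq0/matrixP.
  by move=> /(_ (Ordinal n0) 0); rewrite !mxE => /eqP; rewrite oner_eq0.
have D := descent 0 w HG HL.
have C := strongly_convex_gradient (u := w) (@segment_closedT n) ch I I (HG 0).
move: D C; rewrite add0r subr0 => D C.
have : mu * enorm w ^+ 2 <= L * enorm w ^+ 2 by lra.
by rewrite ler_pM2r.
Qed.

(** Expand the square and use cocoercivity: with the step [2 / (L + mu)] the
    gradient terms cancel exactly, leaving the factor
    [1 - 4 L mu / (L + mu)^2], the square of [(L - mu) / (L + mu)]. *)
Lemma gradient_step_contraction n (h : 'cV[R]_n -> R) (G : 'cV[R]_n -> 'cV[R]_n)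
    (mu L : R) y z :
  0 < mu -> mu <= L -> strongly_convex_on setT mu h ->
  (forall u, is_gradient_on setT h u (G u)) ->
  (forall u u', enorm (G u - G u') <= L * enorm (u - u')) ->
  G z = 0 ->
  enorm (y - (2 / (L + mu)) *: G y - z) <= (L - mu) / (L + mu) * enorm (y - z).
Proof.
move=> mu0 muL ch HG HL Gz.
have Lmu : 0 < L + mu by lra.
have := cocoercive y z ch HG HL; rewrite Gz subr0 => C.
apply: enorm_le; first by rewrite mulr_ge0 ?enorm_ge0// divr_ge0 ?subr_ge0// ltW.
rewrite addrAC; move: (y - z) C => e C; set b := 2 / (L + mu).
have -> : dot (e - b *: G y) (e - b *: G y) =
    enorm e ^+ 2 - 2 * b * dot (G y) e + b ^+ 2 * enorm (G y) ^+ 2.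
  rewrite !enorm_sq !dotE (dotC e); ring.
have C' : b ^+ 2 * (enorm (G y) ^+ 2 + L * mu * enorm e ^+ 2) <=
    2 * b * dot (G y) e.
  have -> : 2 * b * dot (G y) e = b ^+ 2 * ((L + mu) * dot (G y) e).
    by rewrite /b; field; rewrite gt_eqF.
  by rewrite ler_wpM2l ?sqr_ge0.
have -> : ((L - mu) / (L + mu) * enorm e) ^+ 2 =
    enorm e ^+ 2 - b ^+ 2 * (L * mu * enorm e ^+ 2).
  by rewrite /b; field; rewrite gt_eqF.
by move: C'; rewrite mulrDr; lra.
Qed.

Lemma normr_le_enorm n (v : 'rV[R]_n) : `|v| <= enorm v^T.
Proof.
rewrite /Num.norm /= mx_normrE; apply: bigmax_le; first exact: enorm_ge0.
by move=> [i j] _ /=; have := abs_coord_le v^T j; rewrite mxE (ord1 i).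
Qed.

(** Extreme value theorem on the sublevel set of [u0], cut out by a sup-norm ball;
    transposing moves it to row vectors, where bounded closed sets are compact. *)
Lemma closed_argmin n (A : set 'cV[R]_n) (h : 'cV[R]_n -> R) u0 (r : R) :
  closed A -> A u0 -> (forall u, A u -> h u <= h u0 -> enorm u <= r) ->
  (forall u e, 0 < e -> exists2 d : R, 0 < d &
     forall u', enorm (u' - u) < d -> `|h u' - h u| <= e) ->
  argmin_set A h (argmin A h).
Proof.
move=> clA Au0 hr hc; apply: (@getPex _ (argmin_set A h)).
have trc m k : continuous (@trmx R m k).
  move=> x U /nbhs_ballP[e /= e0 eU]; apply/nbhs_ballP; exists e => //= y [_ xy].
  by apply: eU; split=> // i j; rewrite !mxE; exact: xy.
pose B := [set v : 'rV[R]_n | A v^T /\ `|v| <= r].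
have [|||v vB vmin] := @EVT_min_rV R n (h \o trmx) B.
- exists u0^T; split; first by rewrite trmxK.
  by apply: le_trans (normr_le_enorm _) _; rewrite trmxK hr.
- apply: bounded_closed_compact.
    exists r; split; first exact: num_real.
    by move=> M rM v [_ vr]; apply: le_trans vr (ltW rM).
  apply: closedI.
    by have /continuous_closedP := @trc 1%N n; exact.
  have /continuous_closedP : continuous (fun v : 'rV[R]_n => `|v|).
    exact: norm_continuous.
  by move=> /(_ [set x | x <= r]); apply; exact: closed_le.
- apply: continuous_subspaceT => v U /nbhs_ballP[e /= e0 eU].
  have [d d0 dH] := hc v^T _ (divr_gt0 e0 (ltr0Sn R 1)).
  apply: (@trc 1%N n v [set u | U (h u)]).
  have : \forall u \near within setT (nbhs v^T), U (h u).
    apply/near_within_enorm; exists d => // u _ /dH vu; apply: eU.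
    rewrite /ball /= distrC; apply: le_lt_trans vu _; rewrite ltr_pdivrMr//.
    by rewrite ltr_pMr// ltr1n.
  by rewrite near_withinE; apply: filterS => u; exact.
move: vB; rewrite inE => -[Av vr]; exists v^T; split=> // u Au.
have [uu0|/ltW u0u] := leP (h u) (h u0).
  have := vmin u^T; rewrite /= trmxK; apply; rewrite inE; split; first by rewrite trmxK.
  by apply: le_trans (normr_le_enorm _) _; rewrite trmxK hr.
apply: le_trans u0u.
have := vmin u0^T; rewrite /= trmxK; apply; rewrite inE; split; first by rewrite trmxK.
by apply: le_trans (normr_le_enorm _) _; rewrite trmxK hr.
Qed.

(** The first-order lower bound at [0] is a quadratic growth condition, so sublevel
    sets are bounded. *)
Lemma strongly_convex_argmin n (h : 'cV[R]_n -> R) (G : 'cV[R]_n -> 'cV[R]_n) (mu : R) :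
  0 < mu -> strongly_convex_on setT mu h ->
  (forall u, is_gradient_on setT h u (G u)) ->
  argmin_set setT h (argmin setT h).
Proof.
move=> mu0 ch HG; apply: (@closed_argmin _ setT h 0 (2 * enorm (G 0) / mu)) => //.
- move=> u _ uh.
  have := strongly_convex_gradient (u := u) (@segment_closedT n) ch I I (HG 0).
  rewrite subr0 => C; have := CauchySchwarz (G 0) u; rewrite ler_norml => /andP[D _].
  have [u0|u0] := eqVneq (enorm u) 0.
    by rewrite u0 divr_ge0 ?mulr_ge0 ?enorm_ge0// ltW.
  have up : 0 < enorm u by rewrite lt_neqAle eq_sym u0 enorm_ge0.
  rewrite ler_pdivlMr// -(ler_pM2r up); nra.
- move=> u e e0; have /is_gradient_onP /(_ _ ltr01)[d d0 dH] := HG u.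
  have c0 : 0 < 1 + enorm (G u) by rewrite ltr_wpDr ?enorm_ge0.
  exists (Num.min d (e / (1 + enorm (G u)))); first by rewrite lt_min d0 divr_gt0.
  move=> u'; rewrite lt_min => /andP[/(dH _ I) H]; rewrite ltr_pdivlMr// => H2.
  rewrite -[h u' - _](subrK (dot (G u) (u' - u))).
  apply: le_trans (ler_normD _ _) _; have := CauchySchwarz (G u) (u' - u); lra.
Qed.

Lemma proj_argmin n (A : set 'cV[R]_n) p :
  closed A -> A !=set0 ->
  argmin_set A (fun u => enorm (u - p)) (Defs.proj A p).
Proof.
move=> clA [u0 Au0].
apply: (closed_argmin (u0 := u0) (r := enorm (u0 - p) + enorm p)) => //.
  by move=> u _ H; have := enormD (u - p) p; rewrite subrK; lra.
move=> u e e0; exists e => // u' u'e; rewrite ler_norml; apply/andP; split.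
  by have := enorm_dist u' u p; rewrite (enormBC u u'); lra.
by have := enorm_dist u u' p; lra.
Qed.

(** The projection also minimises the squared distance to [p], whose gradient at
    [u] is twice [u - p]; the inequality is the first-order optimality
    condition. *)
Lemma proj_obtuse n (A : set 'cV[R]_n) p u :
  closed A -> segment_closed A -> A u ->
  A (Defs.proj A p) /\ dot (p - Defs.proj A p) (u - Defs.proj A p) <= 0.
Proof.
move=> clA cA Au; have [Aq qmin] : argmin_set A (fun u => enorm (u - p)) (Defs.proj A p).
  by apply: proj_argmin => //; exists u.
split=> //; set q := Defs.proj A p in Aq qmin *.
have := @argmin_gradient _ A (fun u => 1 * enorm (u - p) ^+ 2) q u _ cA _ Au
  (is_gradient_on_sqdist A 1 p q).
rewrite -[p - q]opprB dotNl mulr1 dotZl oppr_le0 pmulr_rge0//; apply.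
by split=> // v Av; rewrite !mul1r ler_pXn2r ?nnegrE ?enorm_ge0 ?qmin.
Qed.

End Convexity.
(** * Operator norms and coercive matrices *)

Section OperatorNorm.
Context {R : realType}.
Implicit Types (n m : nat).

Lemma enorm_mulmx_opnorm m n (A : 'M[R]_(m, n)) u :
  enorm (A *m u) <= opnorm A * enorm u.
Proof.
pose c := \sum_i enorm (row i A)^T.
have ub : has_ubound [set enorm (A *m v) | v in [set v : 'cV[R]_n | enorm v <= 1]].
  exists (m%:R * c) => _ [v /= v1 <-]; apply: enorm_le_coord => [|i].
    by apply: sumr_ge0 => i _; exact: enorm_ge0.
  have -> : (A *m v) i 0 = dot (row i A)^T v.
    by rewrite mxE; apply: eq_bigr => j _; rewrite !mxE.
  apply: le_trans (CauchySchwarz _ _) _; rewrite /c (bigD1 i)//=.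
  apply: (@le_trans _ _ (enorm (row i A)^T)).
    by rewrite -[leRHS]mulr1 ler_wpM2l ?enorm_ge0.
  by rewrite lerDl; apply: sumr_ge0 => j _; exact: enorm_ge0.
have [u0|u0] := eqVneq (enorm u) 0.
  by rewrite (enorm_eq0 u0) mulmx0 !enorm0 mulr0.
have up : 0 < enorm u by rewrite lt_neqAle eq_sym u0 enorm_ge0.
have -> : enorm (A *m u) = enorm (A *m ((enorm u)^-1 *: u)) * enorm u.
  by rewrite -scalemxAr enormZ gtr0_norm ?invr_gt0// mulrAC mulVf// mul1r.
rewrite ler_wpM2r ?enorm_ge0//; apply: (ub_le_sup ub).
by exists ((enorm u)^-1 *: u) => //=; rewrite enormZ gtr0_norm ?invr_gt0// mulVf.
Qed.

(** Coercivity gives [mu * enorm w <= enorm (A *m w)], so [A] is injective, hence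
    invertible, and its inverse has norm at most [1 / mu]. *)
Lemma coercive_mulmx_onto n (A : 'M[R]_n) (mu : R) :
  0 < mu -> (forall u, mu * enorm u ^+ 2 <= dot (A *m u) u) ->
  forall v, exists2 w, A *m w = v & mu * enorm w <= enorm v.
Proof.
move=> mu0 HA v.
have low w : mu * enorm w <= enorm (A *m w).
  have [w0|w0] := eqVneq (enorm w) 0; first by rewrite w0 mulr0 enorm_ge0.
  have wp : 0 < enorm w by rewrite lt_neqAle eq_sym w0 enorm_ge0.
  rewrite -(ler_pM2r wp); have := HA w; have := dot_le (A *m w) w.
  by rewrite expr2; lra.
have uA : A \in unitmx.
  rewrite -unitmx_tr -row_free_unit; apply/inj_row_free => r rA.
  have := low r^T; rewrite -[A]trmxK -trmx_mul rA trmx0 enorm0 => H.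
  have : enorm r^T <= 0 by rewrite -(ler_pM2l mu0) mulr0.
  move=> r0; rewrite -[r]trmxK (@enorm_eq0 _ _ r^T) ?trmx0//.
  by apply/eqP; rewrite eq_le r0 enorm_ge0.
exists (invmx A *m v); first by rewrite mulKVmx.
by have := low (invmx A *m v); rewrite mulKVmx.
Qed.

(** Bounds [A] from the values of [A *m B]; it is applied with [B] the Hessian in
    [y] of the inner objective and [A] the matrix solving the linear system of
    the hypergradient, which is only known through that product. *)
Lemma enorm_mulmx_comp_le m n (A : 'M[R]_(m, n)) (B : 'M[R]_n) (mu c : R) :
  0 < mu -> 0 <= c -> (forall u, mu * enorm u ^+ 2 <= dot (B *m u) u) ->
  (forall u, enorm (A *m B *m u) <= c * enorm u) ->
  forall v, enorm (A *m v) <= c / mu * enorm v.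
Proof.
move=> mu0 c0 HB HAB v; have [w <- wv] := coercive_mulmx_onto mu0 HB v.
rewrite mulmxA; apply: le_trans (HAB w) _.
by rewrite -mulrA ler_wpM2l// mulrC ler_pdivlMr// mulrC.
Qed.

End OperatorNorm.

(** * One projected step along an inexact gradient *)

Section ProjectedGradient.
Context {R : realType} {n : nat}.
Context (X : set 'cV[R]_n) (F : 'cV[R]_n -> R) (muf LF : R) (x xo v vo : 'cV[R]_n).
Context (X_closed : closed X) (X_segment : segment_closed X)
  (F_convex : strongly_convex_on X muf F)
  (Xx : X x) (xoP : argmin_set X F xo)
  (vP : is_gradient_on X F x v) (voP : is_gradient_on X F xo vo)
  (v_lip : enorm (v - vo) <= LF * enorm (x - xo)).

(** Add the two first-order inequalities at [x] and [xo]. *)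
Lemma gradient_gap_monotone : muf * enorm (x - xo) ^+ 2 <= dot (v - vo) (x - xo).
Proof.
have H1 := strongly_convex_gradient X_segment F_convex Xx xoP.1 vP.
have H2 := strongly_convex_gradient X_segment F_convex xoP.1 Xx voP.
rewrite dotBl; move: H1 H2; rewrite (enormBC xo x) -[xo - x]opprB dotNr; lra.
Qed.

Lemma muf_le_LF : x != xo -> muf <= LF.
Proof.
move=> xxo; have e0 : 0 < enorm (x - xo).
  rewrite lt_neqAle enorm_ge0 andbT eq_sym; apply: contraNneq xxo => /enorm_eq0.
  by move/eqP; rewrite subr_eq0.
have := gradient_gap_monotone; have := dot_le (v - vo) (x - xo).
move=> /le_trans/(_ (ler_wpM2r (ltW e0) v_lip)) H1 /le_trans/(_ H1).
by rewrite expr2 mulrA !ler_pM2r.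
Qed.

(** The minimiser [xo] is a fixed point of the exact projected step, by its
    optimality condition. The variational characterisation of the projection then
    bounds the new distance by the norm of
    [x - xo - alpha *: (v - vo) - alpha *: (h - v)], and the exact part contracts
    by strong monotonicity and the Lipschitz bound. *)
Lemma projected_step_contraction (alpha q e : R) h :
  0 < alpha -> 0 <= q -> 1 - 2 * (alpha * muf) + (alpha * LF) ^+ 2 <= q ^+ 2 ->
  enorm (h - v) <= e ->
  X (Defs.proj X (x - alpha *: h)) /\
  enorm (Defs.proj X (x - alpha *: h) - xo) <= q * enorm (x - xo) + alpha * e.
Proof.
move=> al0 q0 Hq He.
have [Xx' Ho] := proj_obtuse (x - alpha *: h) X_closed X_segment xoP.1.
split=> //; set x' := Defs.proj _ _ in Xx' Ho *.
have Hopt := argmin_gradient X_segment xoP Xx' voP.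
pose w := (x - xo) - alpha *: (v - vo); pose b := w - alpha *: (h - v).
have H1 : enorm (x' - xo) ^+ 2 <= dot b (x' - xo).
  have -> : b = (x - alpha *: h - x') + (x' - xo) + alpha *: vo.
    by apply/matrixP => i j; rewrite !mxE; ring.
  rewrite dotDl dotDl dotZl enorm_sq; move: Ho; rewrite -[xo - x']opprB dotNr.
  by have := mulr_ge0 (ltW al0) Hopt; lra.
have H2 : enorm (x' - xo) <= enorm b.
  have [u0|u0] := eqVneq (enorm (x' - xo)) 0; first by rewrite u0 enorm_ge0.
  have up : 0 < enorm (x' - xo) by rewrite lt_neqAle eq_sym u0 enorm_ge0.
  by rewrite -(ler_pM2r up) -expr2; apply: le_trans H1 (dot_le _ _).
apply: le_trans H2 (le_trans (enormB _ _) _); rewrite enormZ (gtr0_norm al0).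
apply: lerD; last by rewrite ler_wpM2l// ltW.
apply: enorm_le; first by rewrite mulr_ge0 ?enorm_ge0.
have H3 := gradient_gap_monotone.
have H4 : enorm (v - vo) ^+ 2 <= LF ^+ 2 * enorm (x - xo) ^+ 2.
  by rewrite -exprMn ler_pXn2r ?nnegrE ?enorm_ge0// (le_trans (enorm_ge0 _) v_lip).
have -> : dot w w = enorm (x - xo) ^+ 2 - 2 * alpha * dot (v - vo) (x - xo)
    + alpha ^+ 2 * enorm (v - vo) ^+ 2.
  rewrite /w; move: (v - vo) (x - xo) => c d; rewrite !enorm_sq !dotE (dotC d c); ring.
have H5 := ler_wpM2l (ltW (mulr_gt0 (ltr0Sn R 1) al0)) H3.
have H6 := ler_wpM2l (sqr_ge0 alpha) H4.
have H7 := ler_wpM2r (sqr_ge0 (enorm (x - xo))) Hq.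
by rewrite exprMn; move: H7; rewrite exprMn; lra.
Qed.

(** Convexity at [x] bounds the gap by [dot v (x - xo)]; write [v] as
    [(v - vo) + vo] and replace [vo] by the gradient chosen by [gradient_on], which
    agrees with it on directions of [X]. *)
Lemma gap_le_gradient_sq : 0 <= muf ->
  F x - F xo <= enorm (gradient_on X F xo) ^+ 2 + (LF + 1) * enorm (x - xo) ^+ 2.
Proof.
move=> muf_ge0.
have H := strongly_convex_gradient X_segment F_convex Xx xoP.1 vP.
have T := gradient_on_tangent X_segment xoP.1 Xx voP.
have H1 := dot_le (gradient_on X F xo) (x - xo); rewrite T in H1.
have H2 := dot_le (v - vo) (x - xo).
have H3 := ler_wpM2r (enorm_ge0 (x - xo)) v_lip.
move: H H2; rewrite -[xo - x]opprB dotNr enormN dotBl => H H2.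
have := sqr_ge0 (enorm (gradient_on X F xo) - enorm (x - xo)).
have := mulr_ge0 muf_ge0 (sqr_ge0 (enorm (x - xo))).
have := sqr_ge0 (enorm (x - xo)); have := sqr_ge0 (enorm (gradient_on X F xo)).
nra.
Qed.

End ProjectedGradient.

(** * One round of the bilevel problem *)

Section Round.
Context {R : realType} {d1 d2 : nat}.
Context (lf0 lf1 lg1 lg2 mug : R).
Context (lf0_ge0 : 0 <= lf0) (lf1_gt0 : 0 < lf1) (lg1_gt0 : 0 < lg1)
  (lg2_ge0 : 0 <= lg2) (mug_gt0 : 0 < mug).
Context (X : set 'cV[R]_d1) (f g : 'cV[R]_(d1 + d2) -> R)
  (gf gg : 'cV[R]_(d1 + d2) -> 'cV[R]_(d1 + d2))
  (Hg : 'cV[R]_(d1 + d2) -> 'M[R]_(d1 + d2))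
  (M : 'cV[R]_d1 -> 'cV[R]_d2 -> 'M[R]_(d1, d2)).
Context (X_segment : segment_closed X)
  (gfP : forall z, cylinder X z -> is_gradient_on (cylinder X) f z (gf z))
  (ggP : forall z, cylinder X z -> is_gradient_on (cylinder X) g z (gg z))
  (HgP : forall z, cylinder X z -> is_jacobian_on (cylinder X) gg z (Hg z))
  (f_lip : forall z z', cylinder X z -> cylinder X z' ->
     `|f z - f z'| <= lf0 * enorm (z - z'))
  (g_convex : forall x, X x ->
     strongly_convex_on setT mug (fun y => g (col_mx x y)))
  (gf_lip : forall z z', cylinder X z -> cylinder X z' ->
     enorm (gf z - gf z') <= lf1 * enorm (z - z'))
  (gg_lip : forall z z', cylinder X z -> cylinder X z' ->
     enorm (gg z - gg z') <= lg1 * enorm (z - z'))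
  (Hg_lip : forall z z', cylinder X z -> cylinder X z' ->
     opnorm (Hg z - Hg z') <= lg2 * enorm (z - z'))
  (MP : forall x y, X x ->
     M x y *m hess_yy (Hg (col_mx x y)) + hess_xy (Hg (col_mx x y)) = 0).

Local Notation cyl := (cylinder X : set 'cV[R]_(d1 + d2)).
Local Notation Ly' := (Ly lg1 mug).
Local Notation Mf' := (Mf lf0 lf1 lg1 lg2 mug).
Local Notation y_ x := (ystar g x).
Local Notation gy x y := (dsubmx (gg (col_mx x y))).

Lemma cylinder_col x (y : 'cV[R]_d2) : X x -> cyl (col_mx x y).
Proof. by rewrite /cylinder /= col_mxKu. Qed.

Lemma col_mxB (x x' : 'cV[R]_d1) (y y' : 'cV[R]_d2) :
  col_mx x y - col_mx x' y' = col_mx (x - x') (y - y').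
Proof. by rewrite opp_col_mx add_col_mx. Qed.

Lemma partial_gradient (h : 'cV[R]_(d1 + d2) -> R) v x y :
  X x -> is_gradient_on cyl h (col_mx x y) v ->
  is_gradient_on setT (fun y => h (col_mx x y)) y (dsubmx v).
Proof.
move=> Xx /is_gradient_onP H; apply/is_gradient_onP => e /H[d d0 dH].
exists d => // y' _ y'd; have := dH _ (cylinder_col y' Xx).
by rewrite col_mxB subrr enorm_col0 dot_col_mxr dot0r add0r; exact.
Qed.

Lemma g_gradient x : X x -> forall y,
  is_gradient_on setT (fun y => g (col_mx x y)) y (gy x y).
Proof. by move=> Xx y; apply: partial_gradient => //; apply/ggP/cylinder_col. Qed.

Lemma gy_lip x : X x -> forall y y',
  enorm (gy x y - gy x y') <= lg1 * enorm (y - y').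
Proof.
move=> Xx y y'; rewrite -linearB; apply: le_trans (enorm_dsub _) _.
apply: le_trans (gg_lip (cylinder_col _ Xx) (cylinder_col _ Xx)) _.
by rewrite col_mxB subrr enorm_col0.
Qed.

Lemma mug_le_lg1 : X !=set0 -> (0 < d2)%N -> mug <= lg1.
Proof.
move=> [x Xx] d2_gt0.
exact: strong_convexity_le_smoothness d2_gt0 (g_convex Xx) (g_gradient Xx) (gy_lip Xx).
Qed.

Lemma ystarP x : X x -> argmin_set setT (fun y => g (col_mx x y)) (y_ x).
Proof.
by move=> Xx; exact: strongly_convex_argmin mug_gt0 (g_convex Xx) (g_gradient Xx).
Qed.

Lemma gy_ystar x : X x -> gy x (y_ x) = 0.
Proof. by move=> Xx; exact: argmin_gradientT (ystarP Xx) (g_gradient Xx _). Qed.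

Lemma gy_monotone x : X x -> forall y y',
  mug * enorm (y - y') ^+ 2 <= dot (gy x y - gy x y') (y - y').
Proof.
move=> Xx y y'.
have H1 := strongly_convex_gradient (u := y) (@segment_closedT _ _) (g_convex Xx) I I
  (g_gradient Xx y').
have H2 := strongly_convex_gradient (u := y') (@segment_closedT _ _) (g_convex Xx) I I
  (g_gradient Xx y).
rewrite dotBl; move: H1 H2; rewrite (enormBC y' y) -[y' - y]opprB dotNr; lra.
Qed.

(** Both partial gradients vanish at their minimisers, so strong monotonicity at
    [x] compares [y_ x] and [y_ x'] through the change of the partial gradient at
    the fixed point [y_ x']. *)
Lemma ystar_lip x x' : X x -> X x' ->
  enorm (y_ x - y_ x') <= Ly' * enorm (x - x').
Proof.
move=> Xx Xx'; rewrite /Ly mulrAC ler_pdivlMr// mulrC.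
set e := y_ x - y_ x'.
have [e0|e0] := eqVneq (enorm e) 0; first by rewrite e0 mulr0 mulr_ge0 ?enorm_ge0// ltW.
have ep : 0 < enorm e by rewrite lt_neqAle eq_sym e0 enorm_ge0.
rewrite -(ler_pM2r ep).
have := gy_monotone Xx (y_ x) (y_ x'); rewrite -/e gy_ystar// -(gy_ystar Xx').
have := dot_le (gy x' (y_ x') - gy x (y_ x')) e.
have : enorm (gy x' (y_ x') - gy x (y_ x')) <= lg1 * enorm (x - x').
  rewrite -linearB; apply: le_trans (enorm_dsub _) _.
  apply: le_trans (gg_lip (cylinder_col _ Xx') (cylinder_col _ Xx)) _.
  rewrite col_mxB subrr -opprB (_ : col_mx _ _ = - col_mx (x - x') 0).
    rewrite enormN; apply: ler_wpM2l; first exact: ltW.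
    by apply: le_trans (enorm_col_le _ _) _; rewrite enorm0 addr0.
  by rewrite opp_col_mx oppr0.
move=> /(ler_wpM2r (ltW ep)) H1 H2 H3.
by rewrite -mulrA -expr2; apply: le_trans H3 (le_trans H2 H1).
Qed.

Lemma inner_loop_contraction x y k : mug <= lg1 -> X x ->
  enorm (iter k (inner_step gg (2 / (lg1 + mug)) x) y - y_ x) <=
    ((lg1 - mug) / (lg1 + mug)) ^+ k * enorm (y - y_ x).
Proof.
move=> mul Xx; elim: k => [|k IH]; first by rewrite expr0 mul1r.
rewrite iterS; set y' := iter k _ _ in IH *.
apply: le_trans (gradient_step_contraction y' mug_gt0 mul (g_convex Xx)
  (g_gradient Xx) (gy_lip Xx) (gy_ystar Xx)) _.
move: IH; set r := _ / (_ + _) => IH; rewrite exprS -mulrA ler_wpM2l// divr_ge0 ?subr_ge0//.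
by rewrite addr_ge0// ltW.
Qed.

Lemma hess_yyE (H : 'M[R]_(d1 + d2)) u :
  hess_yy H *m u = dsubmx (H *m col_mx (0 : 'cV[R]_d1) u).
Proof. by rewrite -[in RHS](submxK H) mul_block_col !mulmx0 !add0r col_mxKd. Qed.

Lemma hess_xyE (H : 'M[R]_(d1 + d2)) u :
  hess_xy H *m u = usubmx (H *m col_mx (0 : 'cV[R]_d1) u).
Proof. by rewrite -[in RHS](submxK H) mul_block_col !mulmx0 !add0r col_mxKu. Qed.

(** Directions [col_mx 0 u] stay in the cylinder, so the columns of the Hessian
    in [y] are genuine directional derivatives of the gradient, even where [X] is
    flat; norm bounds and coercivity of these blocks are read off from the
    difference quotients. *)
Lemma hess_expand x y (u : 'cV[R]_d2) (e : R) : X x -> 0 < e ->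
  exists2 s : R, 0 < s &
    enorm (gg (col_mx x (y + s *: u)) - gg (col_mx x y)
      - s *: (Hg (col_mx x y) *m col_mx 0 u)) <= e * (s * enorm u).
Proof.
move=> Xx e0; have /is_jacobian_onP/(_ e e0)[d d0 dH] := HgP (cylinder_col y Xx).
have c0 : 0 < enorm u + 1 by rewrite ltr_wpDl ?enorm_ge0.
exists (d / 2 / (enorm u + 1)); first by rewrite !divr_gt0.
set s := _ / (_ + 1); have s0 : 0 < s by rewrite !divr_gt0.
have := dH _ (cylinder_col (y + s *: u) Xx); rewrite col_mxB subrr addrAC subrr add0r.
rewrite enorm_col0 enormZ gtr0_norm//.
have -> : col_mx 0 (s *: u) = s *: col_mx (0 : 'cV[R]_d1) u.
  by rewrite scale_col_mx scaler0.
rewrite -scalemxAr; apply; apply: (@le_lt_trans _ _ (s * (enorm u + 1))).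
  by rewrite ler_wpM2l ?lerDl// ltW.
by rewrite /s divfK ?gt_eqF//; lra.
Qed.

Lemma hess_norm x y u : X x ->
  enorm (Hg (col_mx x y) *m col_mx 0 u) <= lg1 * enorm u.
Proof.
move=> Xx; apply/ler_addgt0Pr => e e0.
have c0 : 0 < enorm u + 1 by rewrite ltr_wpDl ?enorm_ge0.
have [s s0 H] := hess_expand y u Xx (divr_gt0 e0 c0).
have := gg_lip (cylinder_col (y + s *: u) Xx) (cylinder_col y Xx).
rewrite col_mxB subrr addrAC subrr add0r enorm_col0 enormZ (gtr0_norm s0) => H2.
rewrite -(ler_pM2l s0).
have -> : s * enorm (Hg (col_mx x y) *m col_mx 0 u) =
   enorm (s *: (Hg (col_mx x y) *m col_mx 0 u)) by rewrite enormZ gtr0_norm.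
move: H; set G := gg _ - gg _ in H2 *; set w := s *: (_ *m _) => H.
have := enorm_dist G w 0; rewrite !subr0 enormBC => H3.
have : e / (enorm u + 1) * (s * enorm u) <= s * e.
  rewrite mulrCA ler_wpM2l ?(ltW s0)// mulrAC ler_pdivrMr// ler_wpM2l ?ltW//.
  by rewrite ltrDl.
lra.
Qed.

Lemma hess_yy_coercive x y u : X x ->
  mug * enorm u ^+ 2 <= dot (hess_yy (Hg (col_mx x y)) *m u) u.
Proof.
move=> Xx; apply/ler_addgt0Pr => e e0.
have c0 : 0 < enorm u ^+ 2 + 1 by rewrite ltr_wpDl ?sqr_ge0.
have [s s0 H] := hess_expand y u Xx (divr_gt0 e0 c0).
have := gy_monotone Xx (y + s *: u) y.
rewrite addrAC subrr add0r enormZ (gtr0_norm s0) dotZr => H2.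
rewrite hess_yyE.
move: H; set h := Hg _ *m _ => H.
have D : dot (gy x (y + s *: u) - gy x y - s *: dsubmx h) u <=
    e / (enorm u ^+ 2 + 1) * (s * enorm u) * enorm u.
  apply: le_trans (dot_le _ _) _; rewrite ler_wpM2r ?enorm_ge0//.
  apply: le_trans H; rewrite -linearB -linearZ -linearB.
  exact: enorm_dsub.
have H4 : e / (enorm u ^+ 2 + 1) * (s * enorm u) * enorm u <= s * e.
  rewrite (_ : _ * _ * _ = s * (e * enorm u ^+ 2 / (enorm u ^+ 2 + 1))).
    rewrite ler_wpM2l ?(ltW s0)// ler_pdivrMr// ler_wpM2l ?ltW// ltrDl//.
  by field; rewrite gt_eqF.
move: D; rewrite dotBl dotZl => D.
have : s * (s * (mug * enorm u ^+ 2)) <= s * (s * (dot (dsubmx h) u + e)).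
  move: (ler_wpM2l (ltW s0) D) (ler_wpM2l (ltW s0) H4); rewrite exprMn in H2; nra.
by rewrite !ler_pM2l.
Qed.

Lemma M_hess_yy x y (u : 'cV[R]_d2) : X x ->
  M x y *m hess_yy (Hg (col_mx x y)) *m u = - (hess_xy (Hg (col_mx x y)) *m u).
Proof.
by move=> Xx; apply/eqP; rewrite -subr_eq0 opprK -mulmxDl MP// mul0mx.
Qed.

Lemma M_norm x y (v : 'cV[R]_d2) : X x -> enorm (M x y *m v) <= Ly' * enorm v.
Proof.
move=> Xx; apply: (enorm_mulmx_comp_le mug_gt0 (ltW lg1_gt0)
  (fun u => hess_yy_coercive y u Xx)) => u.
rewrite M_hess_yy// enormN hess_xyE; apply: le_trans (enorm_usub _) _.
exact: hess_norm.
Qed.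

(** Multiplying the difference of the two solutions by the Hessian in [y] at the
    first point leaves only differences of Hessian blocks. *)
Lemma M_lip x y x' y' (v : 'cV[R]_d2) : X x -> X x' ->
  enorm (M x y *m v - M x' y' *m v) <=
    (lg2 + Ly' * lg2) / mug * enorm (col_mx x y - col_mx x' y') * enorm v.
Proof.
move=> Xx Xx'; set z := col_mx x y; set z' := col_mx x' y'.
have Ly0 : 0 <= Ly' by rewrite /Ly divr_ge0 ?ltW.
rewrite -mulmxBl [_ / mug * _]mulrAC.
apply: (enorm_mulmx_comp_le mug_gt0 _ (fun u => hess_yy_coercive y u Xx)) => [|u].
  by rewrite mulr_ge0 ?enorm_ge0// addr_ge0// mulr_ge0.
have -> : (M x y - M x' y') *m hess_yy (Hg (col_mx x y)) *m u =
    - usubmx ((Hg z - Hg z') *m col_mx 0 u)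
    - M x' y' *m dsubmx ((Hg z - Hg z') *m col_mx 0 u).
  have Ex : usubmx ((Hg z - Hg z') *m col_mx 0 u) =
      hess_xy (Hg z) *m u - hess_xy (Hg z') *m u.
    by rewrite -hess_xyE -mulmxBl; congr (_ *m _); apply/matrixP => i j; rewrite !mxE.
  have Ey : dsubmx ((Hg z - Hg z') *m col_mx 0 u) =
      hess_yy (Hg z) *m u - hess_yy (Hg z') *m u.
    by rewrite -hess_yyE -mulmxBl; congr (_ *m _); apply/matrixP => i j; rewrite !mxE.
  rewrite Ex Ey mulmxBr !mulmxA (M_hess_yy y' u Xx') -/z' !mulmxBl (M_hess_yy y u Xx) -/z.
  move: (hess_xy (Hg z) *m u) (hess_xy (Hg z') *m u) (_ *m u) => a a' m.
  by rewrite opprK !opprD opprK addrACA subrr addr0.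
have D : enorm ((Hg z - Hg z') *m col_mx 0 u) <= lg2 * enorm (z - z') * enorm u.
  apply: le_trans (enorm_mulmx_opnorm _ _) _; rewrite enorm_col0 ler_wpM2r ?enorm_ge0//.
  by apply: Hg_lip; apply: cylinder_col.
apply: le_trans (enormB _ _) _; rewrite enormN.
have D1 := le_trans (enorm_usub _) D; have D2 := le_trans (enorm_dsub _) D.
have := le_trans (M_norm y' _ Xx') (ler_wpM2l Ly0 D2).
rewrite !mulrDl; move: D1; rewrite -!mulrA; lra.
Qed.

Lemma gfy_norm x y : X x -> enorm (dsubmx (gf (col_mx x y))) <= lf0.
Proof.
move=> Xx; set v := dsubmx _.
have Hv : is_gradient_on setT (fun y => f (col_mx x y)) y v.
  by apply: partial_gradient => //; apply/gfP/cylinder_col.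
have [v0|v0] := eqVneq (enorm v) 0; first by rewrite v0.
have vp : 0 < enorm v by rewrite lt_neqAle eq_sym v0 enorm_ge0.
apply/ler_addgt0Pr => e e0.
have [d d0 dH] := is_gradient_on_dir v Hv (mulr_gt0 e0 vp).
have s0 : 0 < d / 2 by rewrite divr_gt0.
have := dH (d / 2) I; rewrite gtr0_norm// ler_norml => /(_ _)/andP[|H _]; first by lra.
have := f_lip (cylinder_col (y + (d / 2) *: v) Xx) (cylinder_col y Xx).
rewrite col_mxB subrr addrAC subrr add0r enorm_col0 enormZ (gtr0_norm s0).
move=> /(le_trans (ler_norm _)) H2; rewrite -enorm_sq in H.
rewrite -(ler_pM2r vp) -(ler_pM2l s0); nra.
Qed.

Lemma Ly_ge0 : 0 <= Ly'.
Proof. by rewrite /Ly divr_ge0 ?ltW. Qed.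

Lemma Mf_gt0 : 0 < Mf'.
Proof.
have mi : 0 <= mug^-1 by rewrite invr_ge0 ltW.
by rewrite /Mf -addrA ltr_pwDl// addr_ge0// !mulr_ge0// ?addr_ge0// ?mulr_ge0// ?ltW.
Qed.

(** The three parts of [Mf] come from the gradient in [x], from the change of the
    gradient in [y] seen through [M], and from the change of [M] applied to a
    vector of norm at most [lf0]. *)
Lemma hypergrad_lip x y x' y' : X x -> X x' ->
  enorm (hypergrad gf M x y - hypergrad gf M x' y') <=
    Mf' * enorm (col_mx x y - col_mx x' y').
Proof.
move=> Xx Xx'; rewrite /hypergrad.
have Lz := gf_lip (cylinder_col y Xx) (cylinder_col y' Xx').
have Lm := M_lip y y' (dsubmx (gf (col_mx x y))) Xx Xx'.
have Ln := M_norm y' (dsubmx (gf (col_mx x y)) - dsubmx (gf (col_mx x' y'))) Xx'.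
have Lg := gfy_norm y Xx.
set z := col_mx x y in Lz Lm Ln Lg *; set z' := col_mx x' y' in Lz Lm Ln Lg *.
set u := dsubmx (gf z) in Lm Ln Lg *; set u' := dsubmx (gf z') in Ln *.
have -> : usubmx (gf z) + M x y *m u - (usubmx (gf z') + M x' y' *m u') =
   usubmx (gf z - gf z') + ((M x y *m u - M x' y' *m u) + M x' y' *m (u - u')).
  have -> : usubmx (gf z - gf z') = usubmx (gf z) - usubmx (gf z').
    by apply/matrixP => i j; rewrite !mxE.
  by rewrite mulmxBr subrKA opprD addrACA.
apply: le_trans (enormD _ _) _.
have H1 := le_trans (enorm_usub _) Lz.
have H2 : enorm (M x' y' *m (u - u')) <= Ly' * (lf1 * enorm (z - z')).
  apply: le_trans Ln (ler_wpM2l Ly_ge0 _); rewrite -linearB.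
  exact: le_trans (enorm_dsub _) Lz.
have c0 : 0 <= (lg2 + Ly' * lg2) / mug * enorm (z - z').
  by rewrite mulr_ge0 ?enorm_ge0// divr_ge0 ?(ltW mug_gt0)// addr_ge0// mulr_ge0// Ly_ge0.
have H3 := le_trans Lm (ler_wpM2l c0 Lg).
have := enormD (M x y *m u - M x' y' *m u) (M x' y' *m (u - u')).
have -> : Mf' * enorm (z - z') = lf1 * enorm (z - z') +
   ((lg2 + Ly' * lg2) / mug * enorm (z - z') * lf0 + Ly' * (lf1 * enorm (z - z'))).
  by rewrite /Mf /Ly; field; rewrite gt_eqF.
lra.
Qed.

Lemma graph_ystar_lip x x' : X x -> X x' ->
  enorm (col_mx x (y_ x) - col_mx x' (y_ x')) <= (1 + Ly') * enorm (x - x').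
Proof.
move=> Xx Xx'; rewrite col_mxB mulrDl mul1r; apply: le_trans (enorm_col_le _ _) _.
by rewrite lerD2l ystar_lip.
Qed.

(** Implicit differentiation, without differentiating [ystar] itself. If [w] solves [hess_yy *m w = dsubmx (gf z)], symmetry of the Hessian turns the
    difference between the full first-order term of [f] along the graph of [ystar]
    and the hypergradient term into the pairing of [col_mx 0 w] with
    [Hg z *m (z' - z)]. As the partial gradient in [y] vanishes at both ends, this
    pairing is only the remainder of the expansion of [gg], which is small. *)
Lemma outer_gradient x : X x ->
  is_gradient_on X (outer f g) x (hypergrad gf M x (y_ x)).
Proof.
move=> Xx; set y := y_ x; set z := col_mx x y.
have zc : cyl z by exact: cylinder_col.
have [w wE _] := coercive_mulmx_onto mug_gt0 (fun u => hess_yy_coercive y u Xx)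
  (dsubmx (gf z)).
have Ly0 := Ly_ge0; have w0 := enorm_ge0 w.
pose B := (1 + enorm w) * (1 + Ly'); have B0 : 0 < B.
  by rewrite mulr_gt0 ?ltr_wpDr.
have sym a b : (forall s, 0 <= s <= 1 -> X (x + s *: a)) ->
    dot (Hg z *m col_mx a b) (col_mx 0 w) = dot (Hg z *m col_mx 0 w) (col_mx a b).
  move=> Xa; apply: (jacobian_symmetric _ ggP (HgP zc)) => s t s01 _.
  rewrite /cylinder /= !linearD !linearZ /= col_mxKu.
  by rewrite !col_mxKu scaler0 addr0; exact: Xa.
apply/is_gradient_onP => e e0; have e1 : 0 < e / B by rewrite divr_gt0.
have /is_gradient_onP/(_ _ e1)[d d0 dH] := gfP zc.
have [d' d'0 d'H] := (is_jacobian_onP _ _ _ _).1 (HgP zc) _ e1.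
exists (Num.min d d' / (1 + Ly')); first by rewrite divr_gt0 ?lt_min ?d0 ?ltr_wpDr.
move=> x' Xx'; rewrite ltr_pdivlMr ?ltr_wpDr// mulrC => H.
pose y' := y_ x'; pose z' := col_mx x' y'.
have zc' : cyl z' by exact: cylinder_col.
have zz : enorm (z' - z) <= (1 + Ly') * enorm (x' - x) by exact: graph_ystar_lip.
have := le_lt_trans zz H; rewrite lt_min => /andP[zd zd'].
have F1 := dH _ zc' zd; have F2 := d'H _ zc' zd'.
rewrite /outer -/y -/y' -/z -/z'.
have Xa s : 0 <= s <= 1 -> X (x + s *: (x' - x)) by exact: X_segment.
have key : dot (gf z) (z' - z) - dot (hypergrad gf M x y) (x' - x) =
    - dot (gg z' - gg z - Hg z *m (z' - z)) (col_mx 0 w).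
  have E : z' - z = col_mx (x' - x) (y' - y) by rewrite col_mxB.
  have Z : dot (gg z' - gg z) (col_mx 0 w) = 0.
    by rewrite dotBl !dot_col_mxr !dot0r !add0r !gy_ystar// dot0l subrr.
  rewrite dotBl Z sub0r opprK E sym// !dot_col_mxr -hess_xyE -hess_yyE.
  rewrite wE /hypergrad -/z -wE mulmxA M_hess_yy// -/z wE dotDl dotNl; ring.
have -> : f z' - f z - dot (hypergrad gf M x y) (x' - x) =
  (f z' - f z - dot (gf z) (z' - z)) +
    (dot (gf z) (z' - z) - dot (hypergrad gf M x y) (x' - x)) by ring.
apply: le_trans (ler_normD _ _) _; rewrite key normrN.
have F3 := CauchySchwarz (gg z' - gg z - Hg z *m (z' - z)) (col_mx 0 w).
rewrite enorm_col0 in F3.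
have F4 := le_trans F3 (ler_wpM2r w0 F2).
apply: (@le_trans _ _ (e / B * enorm (z' - z) * (1 + enorm w))).
  by rewrite mulrDr mulr1 lerD.
apply: (@le_trans _ _ (e / B * ((1 + Ly') * enorm (x' - x)) * (1 + enorm w))).
  by rewrite ler_wpM2r ?addr_ge0// ler_wpM2l// ltW.
rewrite le_eqVlt; apply/orP; left; apply/eqP; rewrite /B; field.
by rewrite !gt_eqF ?ltr_wpDr.
Qed.

Local Notation LF := (2 * Mf' * Ly').
Context (X_closed : closed X) (muf alpha : R) (muf_gt0 : 0 < muf)
  (alpha_gt0 : 0 < alpha) (xo : 'cV[R]_d1)
  (outer_convex : strongly_convex_on X muf (outer f g))
  (xoP : argmin_set X (outer f g) xo) (Ly_ge1 : 1 <= Ly')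
  (alpha_LF : alpha * LF ^+ 2 <= muf / 32).

Lemma hypergrad_opt_lip x : X x ->
  enorm (hypergrad gf M x (y_ x) - hypergrad gf M xo (y_ xo)) <= LF * enorm (x - xo).
Proof.
move=> Xx; apply: le_trans (hypergrad_lip _ _ Xx xoP.1) _.
have -> : LF * enorm (x - xo) = Mf' * (2 * Ly' * enorm (x - xo)) by ring.
rewrite ler_wpM2l ?(ltW Mf_gt0)//; apply: le_trans (graph_ystar_lip Xx xoP.1) _.
by rewrite ler_wpM2r ?enorm_ge0// mulr_natl mulr2n lerD2r.
Qed.

(** As soon as [X] has two points, strong convexity of the outer objective is at
    most its smoothness [LF], so the bound on [alpha] makes [alpha * muf] small. *)
Lemma alpha_muf_small x : X x -> x != xo -> alpha * muf <= 1 / 32.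
Proof.
move=> Xx xxo.
have mL := muf_le_LF X_segment outer_convex Xx xoP (outer_gradient Xx)
  (outer_gradient xoP.1) (hypergrad_opt_lip Xx) xxo.
have m2 : alpha * muf ^+ 2 <= muf / 32.
  apply: le_trans alpha_LF; rewrite ler_pM2l// ler_pXn2r ?nnegrE ?(ltW muf_gt0)//.
  exact: le_trans (ltW muf_gt0) mL.
rewrite -(ler_pM2r muf_gt0); move: m2; rewrite expr2; lra.
Qed.

(** The contraction factor: with [a = alpha * muf], the square of
    [1 - 63 / 64 * a] exceeds [1 - 2 * a + a / 32]. *)
Lemma outer_step x y : alpha * muf <= 1 / 32 -> X x ->
  X (Defs.proj X (x - alpha *: hypergrad gf M x y)) /\
  enorm (Defs.proj X (x - alpha *: hypergrad gf M x y) - xo) <=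
    (1 - 63 / 64 * (alpha * muf)) * enorm (x - xo) + alpha * (Mf' * enorm (y - y_ x)).
Proof.
move=> a32 Xx; have a0 : 0 < alpha * muf by rewrite mulr_gt0.
apply: (projected_step_contraction X_closed X_segment outer_convex Xx xoP
  (outer_gradient Xx) (outer_gradient xoP.1) (hypergrad_opt_lip Xx)) => //.
- by lra.
- have : (alpha * LF) ^+ 2 <= alpha * muf / 32.
    by rewrite exprMn expr2 -!mulrA ler_pM2l// mulrA.
  move: a0 a32; set a := alpha * muf; nra.
- apply: le_trans (hypergrad_lip _ _ Xx Xx) _.
  by rewrite col_mxB subrr enorm_col0.
Qed.

Lemma outer_gap_lip x : X x ->
  outer f g x - outer f g xo <= lf0 * (1 + Ly') * enorm (x - xo).
Proof.
move=> Xx; apply: le_trans (ler_norm _) _.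
apply: le_trans (f_lip (cylinder_col _ Xx) (cylinder_col _ xoP.1)) _.
by rewrite -mulrA ler_wpM2l//; exact: graph_ystar_lip xoP.1.
Qed.

Lemma outer_gap_gradient x : X x ->
  outer f g x - outer f g xo <=
    enorm (gradient_on X (outer f g) xo) ^+ 2 + (LF + 1) * enorm (x - xo) ^+ 2.
Proof.
move=> Xx; exact: (gap_le_gradient_sq X_segment outer_convex Xx xoP
  (outer_gradient Xx) (outer_gradient xoP.1) (hypergrad_opt_lip Xx) (ltW muf_gt0)).
Qed.

End Round.
(** * Summing the tracking recursion *)

Section Recursion.
Context {R : realType}.
Implicit Types (V u p q th de : nat -> R) (T t : nat).

(** Adding [(1 - l) * V] over the rounds telescopes; the last term [l * V T] is
    kept to make the induction close. *)
Lemma affine_recursion_sum V u (l : R) T :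
  (0 < T)%N -> 0 <= l -> l < 1 -> (forall t, 0 <= V t) ->
  (forall t, (1 <= t < T)%N -> V t.+1 <= l * V t + u t.+1) ->
  \sum_(1 <= t < T.+1) V t <= (1 - l)^-1 * (V 1%N + \sum_(2 <= t < T.+1) u t).
Proof.
move=> T0 l0 l1 V0 HV; have l1' : 0 < 1 - l by rewrite subr_gt0.
rewrite mulrC ler_pdivlMr// mulrC.
suff H : (1 - l) * (\sum_(1 <= t < T.+1) V t) + l * V T <=
    V 1%N + \sum_(2 <= t < T.+1) u t.
  by apply: le_trans H; rewrite lerDl mulr_ge0.
elim: T T0 HV => // -[_ _ _|T IH _ HV].
  by rewrite big_nat1 big_geq// addr0; lra.
rewrite big_nat_recr//= [in leRHS]big_nat_recr//=.
have H2 := HV T.+1 (ltnSn _).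
have H1 : (1 - l) * (\sum_(1 <= t < T.+2) V t) + l * V T.+1 <=
    V 1%N + \sum_(2 <= t < T.+2) u t.
  by apply: IH => // t /andP[t1 t2]; apply: HV; rewrite t1/= leqW.
by move: H1 H2; set S := \sum_(_ <= _ < _) V _; set S' := \sum_(_ <= _ < _) u _; lra.
Qed.

Lemma affine_recursion_sum_sq V u (l : R) T :
  (0 < T)%N -> 0 <= l -> l < 1 -> (forall t, 0 <= V t) ->
  (forall t, (1 <= t < T)%N -> V t.+1 <= l * V t + u t.+1) ->
  \sum_(1 <= t < T.+1) V t ^+ 2 <=
    (1 - l)^-1 * (V 1%N ^+ 2 + (1 - l)^-1 * \sum_(2 <= t < T.+1) u t ^+ 2).
Proof.
move=> T0 l0 l1 V0 HV; have l1' : 0 < 1 - l by rewrite subr_gt0.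
rewrite mulr_sumr.
apply: (@affine_recursion_sum (fun t => V t ^+ 2) (fun t => (1 - l)^-1 * u t ^+ 2)) => //.
  by move=> t; exact: sqr_ge0.
move=> t ht; have H := HV t ht.
(* Jensen for the square, with weights l and 1 - l *)
have J : (l * V t + u t.+1) ^+ 2 <= l * V t ^+ 2 + (1 - l)^-1 * u t.+1 ^+ 2.
  rewrite -subr_ge0.
  have -> : l * V t ^+ 2 + (1 - l)^-1 * u t.+1 ^+ 2 - (l * V t + u t.+1) ^+ 2 =
     l * ((1 - l) * V t - u t.+1) ^+ 2 / (1 - l) by field; rewrite gt_eqF.
  by rewrite divr_ge0 ?(ltW l1')// mulr_ge0// sqr_ge0.
apply: le_trans J; by rewrite ler_pXn2r ?nnegrE// (le_trans (V0 _) H).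
Qed.

(** The outer error [th] feeds the inner error [de] through [r * Ly], and [de] feeds
    [th] through [b]. Weighting [de] by [1 / (2 * Ly)] costs the outer error at
    most [r <= a / 2], less than its contraction [63 / 64 * a], while the inner
    error has plenty of room since [b * Ly] and [r] are small. *)
Lemma lyapunov_step (a b r Ly th de th' de' p q : R) :
  0 < a -> a <= 1 / 32 -> 0 <= r -> r <= a / 2 -> 1 <= Ly -> b * Ly <= 1 / 64 ->
  0 <= th -> 0 <= de -> 0 <= p -> 0 <= q ->
  th' <= (1 - 63 / 64 * a) * th + b * de + p ->
  de' <= r * (de + Ly * th + q + Ly * th') ->
  th' + de' / (2 * Ly) <= (1 - a / 4) * (th + de / (2 * Ly)) + 2 * (p + q).
Proof.
move=> a0 a1 r0 ra Ly1 bLy th0 de0 p0 q0 Hth Hde.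
have Ly0 : 0 < Ly by lra.
set d := de / (2 * Ly); have d0 : 0 <= d by rewrite divr_ge0 ?mulr_ge0 ?(ltW Ly0).
have deE : de = 2 * Ly * d by rewrite /d; field; rewrite gt_eqF.
have Hd : de' / (2 * Ly) <= r * (d + th / 2 + q + th' / 2).
  rewrite ler_pdivrMr ?mulr_gt0//; apply: le_trans Hde _.
  rewrite -mulrA ler_wpM2l// deE; nra.
have Hth' : th' <= (1 - 63 / 64 * a) * th + d / 32 + p.
  apply: le_trans Hth _; rewrite lerD2r lerD2l deE.
  by rewrite (_ : b * (2 * Ly * d) = 2 * (b * Ly) * d); [nra|ring].
have r1 : r <= 1 / 64 by lra.
have H1 : r * th' <= r * ((1 - 63 / 64 * a) * th + d / 32 + p) by rewrite ler_wpM2l.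
have rth : r * th <= a / 2 * th by rewrite ler_wpM2r.
have rd : r * d <= 1 / 64 * d by rewrite ler_wpM2r.
have rp : r * p <= 1 / 64 * p by rewrite ler_wpM2r.
have rq : r * q <= 1 / 64 * q by rewrite ler_wpM2r.
have ath : 0 <= a * th by rewrite mulr_ge0 ?(ltW a0).
have rath : 0 <= r * (a * th) by rewrite mulr_ge0.
have ad : a * d <= 1 / 32 * d by rewrite ler_wpM2r.
nra.
Qed.

Lemma tracking_sums (a b r Ly B : R) th de p q T :
  (0 < T)%N -> 0 < a -> a <= 1 / 32 -> 0 <= r -> r <= a / 2 -> 1 <= Ly ->
  b * Ly <= 1 / 64 ->
  (forall t, [/\ 0 <= th t, 0 <= de t, 0 <= p t & 0 <= q t]) ->
  th 1%N + de 1%N <= B ->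
  (forall t, (1 <= t < T)%N ->
     th t.+1 <= (1 - 63 / 64 * a) * th t + b * de t + p t.+1) ->
  (forall t, (1 <= t < T)%N ->
     de t.+1 <= r * (de t + Ly * th t + q t.+1 + Ly * th t.+1)) ->
  \sum_(1 <= t < T.+1) th t <=
    4 / a * (B + 2 * (\sum_(2 <= t < T.+1) p t + \sum_(2 <= t < T.+1) q t)) /\
  \sum_(1 <= t < T.+1) th t ^+ 2 <=
    4 / a * (B ^+ 2 + 32 / a *
      (\sum_(2 <= t < T.+1) p t ^+ 2 + \sum_(2 <= t < T.+1) q t ^+ 2)).
Proof.
move=> T0 a0 a32 r0 ra Ly1 bLy pos HB Hth Hde.
have Ly0 : 0 < Ly by lra.
pose V t := th t + de t / (2 * Ly); pose u t := 2 * (p t + q t).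
have thV t : 0 <= th t <= V t.
  by have [t0 d0 _ _] := pos t; rewrite t0 lerDl divr_ge0// mulr_ge0// ltW.
have V0 t : 0 <= V t by have /andP[] := thV t; exact: le_trans.
have V1 : V 1%N <= B.
  have [_ d0 _ _] := pos 1%N; apply: le_trans HB; rewrite lerD2l.
  by rewrite ler_pdivrMr ?mulr_gt0// ler_peMr//; lra.
have HV t : (1 <= t < T)%N -> V t.+1 <= (1 - a / 4) * V t + u t.+1.
  move=> ht; have [? ? _ _] := pos t; have [_ _ ? ?] := pos t.+1.
  exact: lyapunov_step a0 a32 r0 ra Ly1 bLy _ _ _ _ (Hth t ht) (Hde t ht).
have l0 : 0 <= 1 - a / 4 by lra.
have l1 : 1 - a / 4 < 1 by lra.
have lE : (1 - (1 - a / 4))^-1 = 4 / a by field; rewrite gt_eqF.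
have c0 : 0 <= 4 / a by rewrite divr_ge0// ltW.
have S1 := affine_recursion_sum T0 l0 l1 V0 HV.
have S2 := affine_recursion_sum_sq T0 l0 l1 V0 HV.
rewrite lE in S1 S2; split.
  apply: (@le_trans _ _ (\sum_(1 <= t < T.+1) V t)).
    by apply: ler_sum => t _; case/andP: (thV t).
  apply: le_trans S1 _; rewrite ler_wpM2l// lerD//.
  by rewrite /u -mulr_sumr -big_split.
apply: (@le_trans _ _ (\sum_(1 <= t < T.+1) V t ^+ 2)).
  apply: ler_sum => t _; case/andP: (thV t) => t0 tV.
  by rewrite ler_pXn2r ?nnegrE.
apply: le_trans S2 _; rewrite ler_wpM2l// lerD//.
  by rewrite ler_pXn2r ?nnegrE// (le_trans (V0 1%N) V1).
have -> : 32 / a = 4 / a * 8 by field; rewrite gt_eqF.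
rewrite -[leRHS]mulrA ler_wpM2l// -big_split mulr_sumr; apply: ler_sum => t _ /=.
rewrite /u; have := sqr_ge0 (p t - q t); nra.
Qed.

End Recursion.

(** * The number of inner iterations *)

Section InnerIterations.
Context {R : realType}.

(** Use [1 - 2 / (kappa + 1) <= exp (- 2 / (kappa + 1))]; the number of iterations
    makes the exponent at most minus the logarithm of [2 * (1 / a + 2)], whose
    inverse is at most [a / 2]. *)
Lemma inner_rate_le (L mu a : R) (K : nat) :
  0 < mu -> mu <= L -> 0 < a ->
  Num.ceil (4^-1 * (kappa L mu + 1) * ln (4 * (1 / a + 2) ^+ 2)) < K%:Z ->
  ((L - mu) / (L + mu)) ^+ K <= a / 2.
Proof.
move=> mu0 muL a0 HK.
have Lmu : 0 < L + mu by lra.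
have k0 : 0 < kappa L mu + 1 by rewrite /kappa addr_gt0// divr_gt0//; lra.
set c : R := 1 / a + 2; have c0 : 0 < c by rewrite /c addr_gt0 ?divr_gt0.
have lnE : ln (4 * c ^+ 2) = 2 * ln (2 * c).
  have -> : 4 * c ^+ 2 = (2 * c) ^+ 2 by ring.
  by rewrite lnXn ?mulr_gt0// [RHS]mulr_natl.
have HK' : (kappa L mu + 1) * ln (2 * c) <= 2 * K%:R.
  have : (4^-1 * (kappa L mu + 1) * ln (4 * c ^+ 2)) <= K%:R.
    apply: le_trans (ceil_ge _) _; rewrite -[K%:R]/((K%:Z)%:~R) ler_int.
    exact: ltW.
  rewrite lnE; lra.
have rho0 : 0 <= (L - mu) / (L + mu) by rewrite divr_ge0 ?subr_ge0 ?(ltW Lmu).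
have H : ((L - mu) / (L + mu)) ^+ K <= (2 * c)^-1.
  apply: (@le_trans _ _ (expR (- (2 / (kappa L mu + 1))) ^+ K)).
    apply: lerXn2r; rewrite ?nnegrE ?expR_ge0//.
    apply: le_trans (expR_ge1Dx _); rewrite le_eqVlt; apply/orP; left; apply/eqP.
    by rewrite /kappa; field; rewrite !gt_eqF.
  rewrite -expRM_natl -[(2 * c)^-1]lnK ?posrE ?invr_gt0 ?mulr_gt0// ler_expR.
  rewrite lnV ?posrE ?mulr_gt0// mulrN lerN2 mulrA ler_pdivlMr// mulrC.
  by rewrite [_ * 2]mulrC.
apply: le_trans H _; rewrite /c.
have -> : (2 * (1 / a + 2))^-1 = a / (2 * (1 + 2 * a)).
  by field; rewrite !gt_eqF//; lra.
rewrite ler_pM2l// lef_pV2 ?posrE//; lra.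
Qed.

End InnerIterations.
(** * The regret bound *)

Lemma convex_set_segment_closed {R : realType} n (X : set 'cV[R]_n) :
  convex_set (X : set (convex_lmodType 'cV[R]_n)) -> segment_closed X.
Proof.
move=> cX u v s Xu Xv s01.
have := cX v u (Itv01 (andP s01).1 (andP s01).2).
rewrite !inE => /(_ Xv Xu); congr (X _); rewrite /conv /=.
by rewrite scalerBr scalerBl scale1r addrCA.
Qed.

Unset Implicit Arguments.
Set Strict Implicit.
Set Printing Implicit Defensive.

Theorem theorem4 (R : realType)
  (lf0 lf1 lg1 lg2 muf mug D D' alpha : R)
  (lf0_ge0 : 0 <= lf0) (lf1_gt0 : 0 < lf1)
  (lg1_gt0 : 0 < lg1) (lg2_ge0 : 0 <= lg2)
  (muf_gt0 : 0 < muf) (mug_gt0 : 0 < mug)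
  (alpha_gt0 : 0 < alpha)
  (alpha_le : alpha <=
     Num.min (1 / lf1)
             (muf / (128 * Mf lf0 lf1 lg1 lg2 mug ^+ 2 * Ly lg1 mug ^+ 2))) :
  exists2 C : R, 0 < C &
  forall (d1 d2 T K : nat) (d1_gt0 : (0 < d1)%N) (d2_gt0 : (0 < d2)%N)
    (T_gt0 : (0 < T)%N)
    (X : set 'cV[R]_d1)
    (f g : nat -> 'cV[R]_(d1 + d2) -> R)
    (gf gg : nat -> 'cV[R]_(d1 + d2) -> 'cV[R]_(d1 + d2))
    (Hg : nat -> 'cV[R]_(d1 + d2) -> 'M[R]_(d1 + d2))
    (M : nat -> 'cV[R]_d1 -> 'cV[R]_d2 -> 'M[R]_(d1, d2))
    (xs xopt : nat -> 'cV[R]_d1) (ys : nat -> 'cV[R]_d2),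
    X !=set0 -> closed X -> convex_set (X : set (convex_lmodType 'cV[R]_d1)) ->
    (* gf, gg, Hg : the gradients of f, g and the Hessian of g *)
    (forall t z, (1 <= t <= T)%N -> cylinder X z ->
       [/\ is_gradient_on (cylinder X) (f t) z (gf t z),
           is_gradient_on (cylinder X) (g t) z (gg t z) &
           is_jacobian_on (cylinder X) (gg t) z (Hg t z)]) ->
    (* (i) *)
    (forall t z z', (1 <= t <= T)%N -> cylinder X z -> cylinder X z' ->
       `|f t z - f t z'| <= lf0 * enorm (z - z')) ->
    (* (ii) *)
    (forall t x, (1 <= t <= T)%N -> X x ->
       strongly_convex_on setT mug (fun y => g t (col_mx x y))) ->
    (* (iii) *)
    (forall t z z', (1 <= t <= T)%N -> cylinder X z -> cylinder X z' ->
       [/\ enorm (gf t z - gf t z') <= lf1 * enorm (z - z'),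
           enorm (gg t z - gg t z') <= lg1 * enorm (z - z') &
           opnorm (Hg t z - Hg t z') <= lg2 * enorm (z - z')]) ->
    (* (iv) *)
    (forall x x', X x -> X x' -> enorm (x - x') <= D) ->
    enorm (ys 1%N - ystar (g 1%N) (xs 1%N)) <= D' ->
    (* (v) *)
    (forall t, (1 <= t <= T)%N ->
       strongly_convex_on X muf (outer (f t) (g t))) ->
    (forall t, (1 <= t <= T)%N -> argmin_set X (outer (f t) (g t)) (xopt t)) ->
    (forall t x y, (1 <= t <= T)%N -> X x ->
       M t x y *m hess_yy (Hg t (col_mx x y)) + hess_xy (Hg t (col_mx x y))
         = 0) ->
    Num.ceil (4^-1 * (kappa lg1 mug + 1)
               * ln (4 * (1 / (alpha * muf) + 2) ^+ 2)) < K%:Z ->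
    is_OAGD T X gf gg M (fun=> alpha) (fun=> 2 / (lg1 + mug)) (fun=> K) xs ys ->
    BDReg T f g xs xopt <=
      C * (1 + Num.min (Slen 1 T g xopt)
                 (\sum_(1 <= t < T.+1)
                     enorm (gradient_on X (outer (f t) (g t)) (xopt t)) ^+ 2
                  + Slen 2 T g xopt)).
Proof.
set L := Ly lg1 mug; set Mfc := Mf lf0 lf1 lg1 lg2 mug.
have L0 : 0 < L by rewrite /L /Ly divr_gt0.
have Mf0 : 0 < Mfc by exact: Mf_gt0.
pose a := alpha * muf; have a0 : 0 < a by rewrite mulr_gt0.
pose LF := 2 * Mfc * L; have LF0 : 0 < LF by rewrite /LF mulr_gt0// mulr_gt0.
have alpha_LF : alpha * LF ^+ 2 <= muf / 32.
  move: alpha_le; rewrite le_min -/Mfc -/L => /andP[_].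
  have P0 : 0 < 128 * Mfc ^+ 2 * L ^+ 2.
    by apply: mulr_gt0 (exprn_gt0 2 L0); apply: mulr_gt0 (exprn_gt0 2 Mf0).
  rewrite (ler_pdivlMr _ _ P0) /LF; lra.
(* absolute values keep the constant positive whatever the signs of D and D' *)
pose B := `|D| + `|D'|; have B0 : 0 <= B by rewrite addr_ge0.
have a4 : 0 <= 4 / a by rewrite divr_ge0// ltW.
have a32' : 0 <= 32 / a by rewrite divr_ge0// ltW.
pose c1 := lf0 * (1 + L); have c1_ge0 : 0 <= c1.
  by rewrite mulr_ge0// addr_ge0// (ltW L0).
pose C1 := c1 * (4 / a * (B + 2)).
pose C2 := (LF + 1) * (4 / a * (B ^+ 2 + 32 / a)).
have C1_ge0 : 0 <= C1 by rewrite mulr_ge0// mulr_ge0// addr_ge0.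
have LF1 : 0 <= LF + 1 by rewrite addr_ge0// ltW.
have C2_ge0 : 0 <= C2.
  by rewrite mulr_ge0// mulr_ge0// addr_ge0// sqr_ge0.
exists (1 + C1 + C2); first by rewrite ltr_wpDr// ltr_wpDr.
move=> d1 d2 T K _ d2_gt0 T_gt0 X f g gf gg Hg M xs xopt ys X_nonempty X_closed
  /convex_set_segment_closed X_segment derivs f_lip g_convex lips diamX y1_close
  outer_convex xoptP MP HK [X1 updates].
have gfP t : (1 <= t <= T)%N -> forall z, cylinder X z ->
    is_gradient_on (cylinder X) (f t) z (gf t z).
  by move=> ht z /(derivs t z ht)[].
have ggP t : (1 <= t <= T)%N -> forall z, cylinder X z ->
    is_gradient_on (cylinder X) (g t) z (gg t z).
  by move=> ht z /(derivs t z ht)[].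
have HgP t : (1 <= t <= T)%N -> forall z, cylinder X z ->
    is_jacobian_on (cylinder X) (gg t) z (Hg t z).
  by move=> ht z /(derivs t z ht)[].
have fL t (ht : (1 <= t <= T)%N) z z' := f_lip t z z' ht.
have gC t (ht : (1 <= t <= T)%N) x := g_convex t x ht.
have MPt t (ht : (1 <= t <= T)%N) x y := MP t x y ht.
have gfL t : (1 <= t <= T)%N -> forall z z', cylinder X z -> cylinder X z' ->
    enorm (gf t z - gf t z') <= lf1 * enorm (z - z').
  by move=> ht z z' cz cz'; have [] := lips t z z' ht cz cz'.
have ggL t : (1 <= t <= T)%N -> forall z z', cylinder X z -> cylinder X z' ->
    enorm (gg t z - gg t z') <= lg1 * enorm (z - z').
  by move=> ht z z' cz cz'; have [] := lips t z z' ht cz cz'.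
have HgL t : (1 <= t <= T)%N -> forall z z', cylinder X z -> cylinder X z' ->
    opnorm (Hg t z - Hg t z') <= lg2 * enorm (z - z').
  by move=> ht z z' cz cz'; have [] := lips t z z' ht cz cz'.
have h1 : (1 <= 1 <= T)%N by [].
have mul : mug <= lg1 := mug_le_lg1 (ggP _ h1) (gC _ h1) (ggL _ h1) X_nonempty d2_gt0.
have L1 : 1 <= L by rewrite /L /Ly ler_pdivlMr// mul1r.
have XS t : (1 <= t <= T)%N -> X (xs t).
  case: t => // -[//|t] /andP[_ tT].
  have [_ ->] := updates t.+1 (ltnW tT).
  by have [x Xx] := X_nonempty; have [] := proj_obtuse (xs t.+1 -
    alpha *: hypergrad (gf t.+1) (M t.+1) (xs t.+1) (ys t.+2)) X_closed X_segment Xx.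
pose th t := enorm (xs t - xopt t).
pose de t := enorm (ys t.+1 - ystar (g t) (xs t)).
pose p t := enorm (xopt t.-1 - xopt t).
pose q t := enorm (ystar (g t.-1) (xopt t.-1) - ystar (g t) (xopt t)).
pose gr t := enorm (gradient_on X (outer (f t) (g t)) (xopt t)).
have SE k : Slen k T g xopt =
  \sum_(2 <= t < T.+1) p t ^+ k + \sum_(2 <= t < T.+1) q t ^+ k by [].
have S_ge0 k : 0 <= Slen k T g xopt.
  by rewrite SE addr_ge0// sumr_ge0// => t _; rewrite exprn_ge0// enorm_ge0.
have G_ge0 : 0 <= \sum_(1 <= t < T.+1) gr t ^+ 2.
  by rewrite sumr_ge0// => t _; exact: sqr_ge0.
have [a32|a32] := leP a (1 / 32); last first.
  (* a step size this large is only compatible with a one-point domain *)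
  have xsE t : (1 <= t <= T)%N -> xs t = xopt t.
    move=> ht; apply: contraTeq a32 => xxo; rewrite -leNgt.
    exact: (alpha_muf_small lf0_ge0 lf1_gt0 lg1_gt0 lg2_ge0 mug_gt0 X_segment (gfP t ht)
      (ggP t ht) (HgP t ht) (fL t ht) (gC t ht) (gfL t ht) (ggL t ht) (HgL t ht)
      (MPt t ht) muf_gt0 alpha_gt0 (outer_convex t ht) (xoptP t ht) L1 alpha_LF
      (XS t ht) xxo).
  rewrite /BDReg big_nat_cond big1 => [|t /andP[/andP[t1 t2] _]]; last first.
    by rewrite xsE ?subrr// t1.
  by rewrite mulr_ge0// ?addr_ge0// le_min S_ge0 addr_ge0.
have step t (ht : (1 <= t <= T)%N) := outer_step lf0_ge0 lf1_gt0 lg1_gt0 lg2_ge0 mug_gt0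
  X_segment (gfP t ht) (ggP t ht) (HgP t ht) (fL t ht) (gC t ht) (gfL t ht) (ggL t ht)
  (HgL t ht) (MPt t ht) X_closed muf_gt0 alpha_gt0 (outer_convex t ht) (xoptP t ht) L1
  alpha_LF (ys t.+1) a32 (XS t ht).
pose r := ((lg1 - mug) / (lg1 + mug)) ^+ K.
have r0 : 0 <= r.
  by rewrite exprn_ge0// divr_ge0 ?subr_ge0// addr_ge0// ltW.
have ra : r <= a / 2 := inner_rate_le mug_gt0 mul a0 HK.
have inner t (ht : (1 <= t <= T)%N) : de t <= r * enorm (ys t - ystar (g t) (xs t)).
  rewrite /de; have [-> _] := updates t ht.
  exact: (inner_loop_contraction lg1_gt0 mug_gt0 (ggP t ht) (gC t ht) (ggL t ht) _ _ mul
    (XS t ht)).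
have bL : alpha * Mfc * L <= 1 / 64.
  have b0 : 0 <= alpha * Mfc * L by apply: mulr_ge0 (ltW L0); apply: mulr_ge0; exact: ltW.
  have : (alpha * Mfc * L) ^+ 2 <= (1 / 64) ^+ 2.
    have : alpha * (alpha * LF ^+ 2) <= alpha * (muf / 32) by rewrite ler_pM2l.
    rewrite (_ : alpha * (alpha * LF ^+ 2) = 4 * (alpha * Mfc * L) ^+ 2);
      last by rewrite /LF; ring.
    by rewrite mulrA -/a => H; clear -H a32; lra.
  by rewrite ler_pXn2r ?nnegrE.
have [||||sum1 sum2] := @tracking_sums R a (alpha * Mfc) r L B th de p q T T_gt0 a0 a32
    r0 ra L1 bL.
- by move=> t; rewrite /th /de /p /q !enorm_ge0.
- apply: lerD.
    apply: le_trans (ler_norm D); apply: diamX; first exact: X1.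
    by have [] := xoptP _ h1.
  apply: le_trans (inner 1%N h1) _; apply: (@le_trans _ _ (1 * `|D'|));
    last by rewrite mul1r.
  apply: ler_pM => //; [exact: enorm_ge0| |exact: le_trans (ler_norm _)].
  by apply: le_trans ra _; clear -a32; lra.
- move=> t /andP[t1 tT]; have ht : (1 <= t <= T)%N by rewrite t1 ltnW.
  have [_ H] := step t ht; have [_ xE] := updates t ht.
  rewrite -xE in H; apply: le_trans (enorm_dist (xopt t) _ _) _.
  by apply: lerD => //; rewrite -(mulrA alpha).
- move=> t /andP[t1 tT]; have ht : (1 <= t <= T)%N by rewrite t1 ltnW.
  have ht' : (1 <= t.+1 <= T)%N by [].
  apply: le_trans (inner t.+1 ht') _; rewrite ler_wpM2l//.
  have Y1 := ystar_lip lg1_gt0 mug_gt0 (ggP t ht) (gC t ht) (ggL t ht) (XS t ht)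
    (xoptP t ht).1.
  have Y2 := ystar_lip lg1_gt0 mug_gt0 (ggP _ ht') (gC _ ht') (ggL _ ht') (xoptP _ ht').1
    (XS _ ht').
  (* from ys t.+1 to its next target through the inner solutions at xs t, at the two
     consecutive optima, and at xs t.+1 *)
  have E1 := enorm_dist (ystar (g t) (xs t)) (ys t.+1) (ystar (g t.+1) (xs t.+1)).
  have E2 := enorm_dist (ystar (g t) (xopt t)) (ystar (g t) (xs t))
    (ystar (g t.+1) (xs t.+1)).
  have E3 := enorm_dist (ystar (g t.+1) (xopt t.+1)) (ystar (g t) (xopt t))
    (ystar (g t.+1) (xs t.+1)).
  rewrite [enorm (xopt t.+1 - _)]enormBC in Y2.
  apply: le_trans E1 _; rewrite -!addrA lerD2l; apply: le_trans E2 (lerD Y1 _).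
  by apply: le_trans E3 _; rewrite lerD2l.
have R1 : BDReg T f g xs xopt <= C1 * (1 + Slen 1 T g xopt).
  apply: (@le_trans _ _ (c1 * \sum_(1 <= t < T.+1) th t)).
    rewrite mulr_sumr; apply: ler_sum_nat => t ht.
    exact: (outer_gap_lip lf0_ge0 lg1_gt0 mug_gt0 (ggP t ht) (fL t ht) (gC t ht) (ggL t ht)
      (xoptP t ht) (XS t ht)).
  have -> : C1 * (1 + Slen 1 T g xopt) = c1 * (4 / a * ((B + 2) * (1 + Slen 1 T g xopt))).
    by rewrite /C1 !mulrA.
  apply: ler_wpM2l => //; apply: le_trans sum1 _; apply: ler_wpM2l => //.
  have -> : \sum_(2 <= t < T.+1) p t + \sum_(2 <= t < T.+1) q t = Slen 1 T g xopt.
    by rewrite SE; congr (_ + _); apply: eq_bigr => t _; rewrite expr1.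
  have := mulr_ge0 B0 (S_ge0 1%N); move: B0; clear; lra.
have R2 : BDReg T f g xs xopt <=
    (1 + C2) * (1 + (\sum_(1 <= t < T.+1) gr t ^+ 2 + Slen 2 T g xopt)).
  apply: (@le_trans _ _ (\sum_(1 <= t < T.+1) gr t ^+ 2 +
      (LF + 1) * \sum_(1 <= t < T.+1) th t ^+ 2)).
    rewrite mulr_sumr -big_split; apply: ler_sum_nat => t ht.
    exact: (outer_gap_gradient lf0_ge0 lf1_gt0 lg1_gt0 lg2_ge0 mug_gt0 X_segment (gfP t ht)
      (ggP t ht) (HgP t ht) (fL t ht) (gC t ht) (gfL t ht) (ggL t ht) (HgL t ht)
      (MPt t ht) muf_gt0 (outer_convex t ht) (xoptP t ht) L1 (XS t ht)).
  have H : (LF + 1) * \sum_(1 <= t < T.+1) th t ^+ 2 <= C2 * (1 + Slen 2 T g xopt).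
    have -> : C2 * (1 + Slen 2 T g xopt) =
        (LF + 1) * (4 / a * ((B ^+ 2 + 32 / a) * (1 + Slen 2 T g xopt))).
      by rewrite /C2 !mulrA.
    apply: ler_wpM2l => //; apply: le_trans sum2 _; apply: ler_wpM2l => //.
    rewrite -SE; have := mulr_ge0 (sqr_ge0 B) (S_ge0 2); have := mulr_ge0 a32' (S_ge0 2).
    have := sqr_ge0 B; move: a32'; clear; lra.
  have := mulr_ge0 C2_ge0 G_ge0; have := S_ge0 2; move: H G_ge0 C2_ge0; clear; lra.
case: (leP (Slen 1 T g xopt)
  (\sum_(1 <= t < T.+1) gr t ^+ 2 + Slen 2 T g xopt)) => _.
  apply: le_trans R1 _; apply: ler_wpM2r; first exact: addr_ge0 ler01 (S_ge0 1%N).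
  by move: C2_ge0; clear; lra.
apply: le_trans R2 _; apply: ler_wpM2r.
  by apply: addr_ge0 => //; exact: addr_ge0 G_ge0 (S_ge0 2).
by move: C1_ge0; clear; lra.
Qed.
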